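(* In the word-RAM model with $O(\log m)$-bit words, assuming the OMv3 Hypothesis, any incremental or decremental $s$-$t$ Shortest Paths algorithm with polynomial preprocessing time needs $m^{(\omega-1)/2-o(1)}$ amortized update or query time.
   Context: $\omega$ denotes the matrix multiplication exponent. OMv3 problem: given an $n\times n$ Boolean matrix $A$ that may be preprocessed, answer $n$ queries online, where each query consists of three length-$n$ Boolean vectors $u,v,w$ and the answer is the Boolean value $\bigvee_{i,j,k}(u_i\wedge v_j\wedge w_k\wedge A[i,j]\wedge A[j,k]\wedge A[k,i])$. OMv3 Hypothesis: any algorithm solving OMv3 with polynomial preprocessing time needs $n^{\omega+1-o(1)}$ total time in the word-RAM model with $O(\log n)$-bit words. In incremental (resp. decremental) $s$-$t$ Shortest Paths, a graph undergoes only edge insertions (resp. deletions), with fixed vertices $s,t$, and queries ask for the current distance from $s$ to $t$; $m$ is the number of edges. *)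

(* Defs.v *)
From HB Require Import structures.
From mathcomp Require Import all_boot all_order all_algebra.
From mathcomp Require Import boolp classical_sets reals exp.

Set Implicit Arguments.
Unset Strict Implicit.
Unset Printing Implicit Defensive.

Import Order.TTheory GRing.Theory Num.Theory.

Local Open Scope nat_scope.

(** * The matrix multiplication exponent *)

(* Division-free straight-line programs over the field F, whose inputs are the
   entries of two n x n matrices X and Y. Only gates are counted; scalars are
   free operands. *)
Inductive operand (F : Type) (n : nat) : Type :=
| InX of 'I_n & 'I_n
| InY of 'I_n & 'I_n
| Scalar of F
| Gate of nat.

Inductive arith_op : Type := ArithAdd | ArithSub | ArithMul.

Definition gate (F : Type) (n : nat) : Type :=
  (arith_op * operand F n * operand F n)%type.

Section StraightLine.
Local Open Scope ring_scope.
Variables (F : fieldType) (n : nat) (S : comAlgType F) (X Y : 'M[S]_n).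

Definition operand_val (vals : seq S) (x : operand F n) : S :=
  match x with
  | InX i j => X i j
  | InY i j => Y i j
  | Scalar c => c%:A
  | Gate k => vals`_k
  end.

Definition gate_val (vals : seq S) (g : gate F n) : S :=
  let x := operand_val vals g.1.2 in
  let y := operand_val vals g.2 in
  match g.1.1 with
  | ArithAdd => x + y
  | ArithSub => x - y
  | ArithMul => x * y
  end.

Definition slp_vals (p : seq (gate F n)) : seq S :=
  foldl (fun vals g => rcons vals (gate_val vals g)) [::] p.

End StraightLine.

(* Correctness over every commutative F-algebra amounts to correctness for
   matrices of indeterminates, also when F is finite. *)
Definition computes_mulmx (F : fieldType) (n : nat) (p : seq (gate F n)) : Prop :=
  exists out : 'I_n -> 'I_n -> operand F n,
    forall (S : comAlgType F) (X Y : 'M[S]_n) (i j : 'I_n),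
      operand_val X Y (slp_vals X Y p) (out i j) = (X *m Y)%R i j.

Definition mm_exponent (R : realType) (F : fieldType) : R :=
  inf [set tau : R | exists K : R, forall n : nat, 0 < n ->
    exists2 p : seq (gate F n),
      computes_mulmx p & ((size p)%:R <= K * n%:R `^ tau)%R]%classic.

(** * The word RAM *)

(* A program may use any constant number of registers and of arrays (memory
   banks); an array has one cell per w-bit address. Control flow is structured. *)
Inductive binop : Type :=
| WAdd | WSub | WMul | WDiv | WMod | WAnd | WOr | WXor | WShl | WShr | WEq | WLt.

Inductive cmd : Type :=
| Skip
| Const of nat & nat             (* Const r k      : r := k          *)
| Op of binop & nat & nat & nat  (* Op o r r1 r2   : r := r1 o r2    *)
| Read of nat & nat & nat        (* Read r a r1    : r := a[r1]      *)
| Write of nat & nat & nat       (* Write a r1 r2  : a[r1] := r2     *)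
| Seq of cmd & cmd
| If of nat & cmd & cmd
| While of nat & cmd.

Record state : Type := State { reg : nat -> nat; arr : nat -> nat -> nat }.

Definition upd {T : Type} (f : nat -> T) (i : nat) (x : T) : nat -> T :=
  fun j => if j == i then x else f j.

Definition set_reg (s : state) (r x : nat) : state :=
  State (upd (reg s) r x) (arr s).

Definition set_arr (s : state) (a : nat) (f : nat -> nat) : state :=
  State (reg s) (upd (arr s) a f).

Definition blank : state := State (fun _ => 0) (fun _ _ => 0).

Definition eval_binop (w : nat) (o : binop) (x y : nat) : nat :=
  match o with
  | WAdd => x + y
  | WSub => x + 2 ^ w - y
  | WMul => x * y
  | WDiv => x %/ y
  | WMod => x %% y
  | WAnd => Nat.land x y
  | WOr => Nat.lor x y
  | WXor => Nat.lxor x y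
  | WShl => x * 2 ^ y
  | WShr => x %/ 2 ^ y
  | WEq => x == y
  | WLt => x < y
  end %% 2 ^ w.

(* [exec w c s t s'] : with w-bit words, c started in s halts in s' after t
   unit-cost steps. *)
Inductive exec (w : nat) : cmd -> state -> nat -> state -> Prop :=
| exec_skip s : exec w Skip s 1 s
| exec_const r k s : exec w (Const r k) s 1 (set_reg s r (k %% 2 ^ w))
| exec_op o r r1 r2 s :
    exec w (Op o r r1 r2) s 1
      (set_reg s r (eval_binop w o (reg s r1) (reg s r2)))
| exec_read r a r1 s :
    exec w (Read r a r1) s 1 (set_reg s r (arr s a (reg s r1)))
| exec_write a r1 r2 s :
    exec w (Write a r1 r2) s 1
      (set_arr s a (upd (arr s a) (reg s r1) (reg s r2)))
| exec_seq c1 c2 s s1 s2 t1 t2 :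
    exec w c1 s t1 s1 -> exec w c2 s1 t2 s2 ->
    exec w (Seq c1 c2) s (t1 + t2) s2
| exec_if r c1 c2 s s' t :
    exec w (if reg s r == 0 then c2 else c1) s t s' ->
    exec w (If r c1 c2) s t.+1 s'
| exec_while_stop r c s :
    reg s r = 0 -> exec w (While r c) s 1 s
| exec_while_step r c s s1 s2 t1 t2 :
    reg s r <> 0 -> exec w c s t1 s1 -> exec w (While r c) s1 t2 s2 ->
    exec w (While r c) s (t1 + t2).+1 s2.

(* Online processing of a sequence of requests: each request is written into
   the current state by [put], its handler is run, and register 0 then holds
   the answer. [serve .. s os rs T]: answers rs, total time T. *)
Inductive serve (w : nat) (O : Type) (handler : O -> cmd)
    (put : O -> state -> state) : state -> seq O -> seq nat -> nat -> Prop :=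
| serve_nil s : serve w handler put s [::] [::] 0
| serve_cons o os rs s s' t T :
    exec w (handler o) (put o s) t s' ->
    serve w handler put s' os rs T ->
    serve w handler put s (o :: os) (reg s' 0 :: rs) (t + T).

(* Words of O(log n) bits; a and b are positive constants, so that the number n
   itself fits in a word. *)
Definition word_size (a b n : nat) : nat := a * trunc_log 2 n + b.

(** * "f(n) >= n^(e - o(1))" : f is not O(n^(e - eps)), for any eps > 0 *)

Definition needs_pow (R : realType) (f : nat -> R) (e : R) : Prop :=
  forall eps K : R, (0 < eps)%R ->
    exists2 n : nat, 0 < n & (K * n%:R `^ (e - eps) < f n)%R.

(** * OMv3 *)

Section OMv3.
Variable n : nat.
Implicit Types (A : 'M[bool]_n) (u v w : 'rV[bool]_n).

Definition omv3_query : Type := ('rV[bool]_n * 'rV[bool]_n * 'rV[bool]_n)%type.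

Definition omv3_answer A (q : omv3_query) : bool :=
  let: (u, v, w) := q in
  [exists i, exists j, exists k,
    [&& u ord0 i, v ord0 j, w ord0 k, A i j, A j k & A k i]].

Definition vec_cells u : nat -> nat :=
  fun k => [exists i : 'I_n, (val i == k) && u ord0 i].

Definition mx_cells A : nat -> nat :=
  fun k => [exists i : 'I_n, exists j : 'I_n, (i * n + j == k) && A i j].

Definition omv3_init A : state := set_arr (set_reg blank 0 n) 0 (mx_cells A).

Definition omv3_put (q : omv3_query) (s : state) : state :=
  let: (u, v, w) := q in
  set_arr (set_arr (set_arr s 1 (vec_cells u)) 2 (vec_cells v)) 3 (vec_cells w).

End OMv3.

Record omv3_alg : Type := OMv3Alg {
  omv3_wa : nat;
  omv3_wb : nat;
  omv3_pre : cmd;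
  omv3_qry : cmd }.

(* P solves OMv3 with polynomial preprocessing time, and the total time spent
   on the n queries is at most T n. *)
Definition solves_omv3 (R : realType) (P : omv3_alg) (T : nat -> R) : Prop :=
  [/\ 0 < omv3_wa P, 0 < omv3_wb P &
  exists C d : nat, forall (n : nat) (A : 'M[bool]_n), 0 < n ->
    let w := word_size (omv3_wa P) (omv3_wb P) n in
    exists (t0 : nat) (s0 : state),
      [/\ exec w (omv3_pre P) (omv3_init A) t0 s0,
          t0 <= C * n ^ d &
          forall qs : n.-tuple (omv3_query n), exists t : nat,
            serve w (fun=> omv3_qry P) (@omv3_put n) s0 qs
              [seq nat_of_bool (omv3_answer A q) | q <- qs] t
            /\ (t%:R <= T n)%R]].

Definition OMv3_hypothesis (R : realType) (omega : R) : Prop :=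
  forall (P : omv3_alg) (T : nat -> R),
    solves_omv3 P T -> needs_pow T (omega + 1)%R.

(** * Partially dynamic s-t Shortest Paths *)

(* Graphs are simple, undirected and unweighted, with vertex set 'I_N; a graph
   is given by a list of its edges, each listed once, in either orientation. *)
Section Graph.
Variable N : nat.
Implicit Types (E : seq ('I_N * 'I_N)) (x y s t : 'I_N).

Definition adj E : rel 'I_N := fun x y => ((x, y) \in E) || ((y, x) \in E).

Definition simple_graph E : bool :=
  all (fun e => e.1 != e.2) E &&
  pairwise (fun e f => (e != f) && (e != (f.2, f.1))) E.

Definition is_walk E s t (p : seq 'I_N) : Prop :=
  path (adj E) s p /\ last s p = t.

(* The distance of s and t, where N stands for infinity. *)
Definition is_distance E s t (d : nat) : Prop :=
  (exists2 p, is_walk E s t p & size p = d) /\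
    (forall p, is_walk E s t p -> d <= size p)
  \/ (forall p, ~ is_walk E s t p) /\ d = N.

End Graph.

Inductive direction : Type := Incremental | Decremental.

Inductive request (N : nat) : Type :=
| Update of 'I_N & 'I_N
| Query.
Arguments Query {N}.

Definition is_query (N : nat) (o : request N) : bool :=
  if o is Query then true else false.

Section Dynamic.
Variables (dir : direction) (N : nat).
Implicit Types (E : seq ('I_N * 'I_N)) (x y s t : 'I_N).

Definition legal_update E x y : bool :=
  match dir with
  | Incremental => (x != y) && ~~ adj E x y
  | Decremental => adj E x y
  end.

Definition update E x y : seq ('I_N * 'I_N) :=
  match dir with
  | Incremental => rcons E (x, y)
  | Decremental => [seq e <- E | (e != (x, y)) && (e != (y, x))]
  end.

(* All updates are legal and the graph never has more than m edges. *)
Fixpoint legal (m : nat) E (os : seq (request N)) : bool :=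
  (size E <= m) &&
  match os with
  | [::] => true
  | Update x y :: os' => legal_update E x y && legal m (update E x y) os'
  | Query :: os' => legal m E os'
  end.

Fixpoint correct_answers s t E (os : seq (request N)) (rs : seq nat) : Prop :=
  match os, rs with
  | [::], [::] => True
  | Update x y :: os', _ :: rs' => correct_answers s t (update E x y) os' rs'
  | Query :: os', r :: rs' => is_distance E s t r /\ correct_answers s t E os' rs'
  | _, _ => False
  end.

End Dynamic.

Definition stsp_init (m N : nat) (s t : 'I_N) (E : seq ('I_N * 'I_N)) : state :=
  let regs := [:: m; N; val s; val t; size E] in
  State (nth 0 regs)
    (fun a => if a == 0 then nth 0 [seq val e.1 | e <- E]
              else if a == 1 then nth 0 [seq val e.2 | e <- E]
              else fun=> 0).

Definition stsp_put (N : nat) (o : request N) (s : state) : state :=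
  if o is Update x y then set_reg (set_reg s 0 x) 1 y else s.

Record stsp_alg : Type := StspAlg {
  stsp_wa : nat;
  stsp_wb : nat;
  stsp_pre : cmd;
  stsp_upd : cmd;
  stsp_qry : cmd }.

Definition stsp_handler (P : stsp_alg) (N : nat) (o : request N) : cmd :=
  if o is Update _ _ then stsp_upd P else stsp_qry P.

(* P solves incremental or decremental s-t Shortest Paths with polynomial
   preprocessing time, amortized update time U m and amortized query time Q m,
   where m bounds the number of edges throughout. The graph has at most m
   vertices, so that vertices fit in a word. As usual for partially dynamic
   algorithms, the update time is amortized over all the edges, including those
   of the initial graph; algorithms whose total time is at most
   #updates * U m + #queries * Q m are a special case (for 0 <= U m). *)
Definition solves_stsp (R : realType) (dir : direction) (P : stsp_alg)
    (U Q : nat -> R) : Prop :=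
  [/\ 0 < stsp_wa P, 0 < stsp_wb P &
  exists C d : nat,
  forall (m N : nat) (s t : 'I_N) (E : seq ('I_N * 'I_N)),
    0 < m -> N <= m -> simple_graph E -> size E <= m ->
    let w := word_size (stsp_wa P) (stsp_wb P) m in
    exists (t0 : nat) (s0 : state),
      [/\ exec w (stsp_pre P) (stsp_init m s t E) t0 s0,
          t0 <= C * m ^ d &
          forall os : seq (request N), legal dir m E os ->
            let updates := count (fun o => ~~ is_query o) os in
            let queries := count (@is_query N) os in
            exists (rs : seq nat) (T : nat),
              [/\ serve w (@stsp_handler P N) (@stsp_put N) s0 os rs T,
                  correct_answers dir s t E os rs &
                  (T%:R <= (size E + updates)%:R * U m
                             + queries%:R * Q m)%R]]].

(* Main.v *)
Require Import Defs.
From mathcomp Require Import all_boot all_order all_algebra.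
From mathcomp Require Import boolp classical_sets reals exp.
From mathcomp Require Import zify ring.

(* Given a partially dynamic s-t shortest paths algorithm, OMv3 is solved on a
   graph with O(n^2) edges and O(n^2) updates and queries in total. The graph is
   layered; writing q = c n + i with c, i < n, its vertices and edges are

     S_q - S_{q+1},  T_q - T_{q+1}            with s = S_0 and t = T_0,
     X_q - X_{q+n},  Y_q - Y_{q+n}            the paths X_{., i}, Y_{., i},
     a_i - X_j,  x_i - Y_j,  y_i - d_j        for A[i, j] = 1,
     S_q - a_i,  T_q - d_i,  X_q - x_i,  Y_q - y_i    the dynamic edges.

   Phase c attaches x_j to X_{cn+j} for v_j = 1 and y_k to Y_{cn+k} for w_k = 1,
   and for each i in turn asks for the distance while S_q - a_i and T_q - d_i are
   the dynamic edges of their kind closest to s and t. As long as no dynamic edge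
   closer to the start of its path is present, the distance is
   at most 2q + 2c + 7 if i lies on a triangle i, j, k with v_j = w_k = 1, and larger
   otherwise; edges farther away do no harm. Hence phases run through c downwards
   with insertions, or upwards with deletions.

   The number m = 64 * 4^(trunc_log 2 n) of edges announced to the algorithm makes
   the two word sizes coincide. If omega <= 1 the claim is trivial, since every
   query takes at least one step. *)

Import Order.TTheory GRing.Theory Num.Theory.
Local Open Scope ring_scope.

(** * The gadget graph *)

Section GadgetGraph.
Set Implicit Arguments.
Unset Strict Implicit.
Local Open Scope nat_scope.

Variable n : nat.
Hypothesis n_gt0 : 0 < n.

Definition code : Type := (nat * nat)%type.

(** With [q = c n + i] the entries are [i], [c], [q], [q + 1] and [q + n]. For edges of types 4 to
    6, [q] stands instead for a matrix entry in row [q / n] and column [q % n]. *)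
Definition position (x q : nat) : nat :=
  nth 0 [:: q %% n; q %/ n; q; q.+1; q + n] x.

(* Row ty gives (kind, position) for both endpoints of the edges of type ty; the
   kinds 0, ..., 7 are S, T, X, Y, a, d, x, y. The edges of types 4, 5, 6 depend
   on the matrix, those of types 7 to 10 are dynamic. *)
Definition edge_table : seq (nat * nat * (nat * nat)) :=
  [:: ((0, 2), (0, 3)); ((1, 2), (1, 3)); ((2, 2), (2, 4)); ((3, 2), (3, 4));
      ((4, 1), (2, 0)); ((6, 1), (3, 0)); ((7, 1), (5, 0));
      ((0, 2), (4, 0)); ((1, 2), (5, 0)); ((2, 2), (6, 0)); ((3, 2), (7, 0))].

Definition edge_shape (ty : nat) : nat * nat * (nat * nat) :=
  nth ((0, 0), (0, 0)) edge_table ty.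

Definition vertex (k r : nat) : nat := k + 8 * r.

Definition src (e : code) : nat :=
  let x := (edge_shape e.1).1 in vertex x.1 (position x.2 e.2).
Definition tgt (e : code) : nat :=
  let x := (edge_shape e.1).2 in vertex x.1 (position x.2 e.2).

Definition valid (e : code) : bool := (e.1 < 11) && (e.2 < n * n).

(* Written as a successor so that [inord] applies; equals 16 n^2 as 0 < n. *)
Definition graph_order : nat := (16 * (n * n)).-1.+1.

Lemma graph_orderE : graph_order = 16 * (n * n).
Proof. by rewrite /graph_order prednK // !muln_gt0 n_gt0. Qed.

Definition oedge (e : code) : 'I_graph_order * 'I_graph_order :=
  (inord (src e), inord (tgt e)).

Lemma type_kinds ty : ty < 11 ->
  ((edge_shape ty).1.1 < 8) && ((edge_shape ty).2.1 < 8).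
Proof.
move=> h; have /allP : all (fun ty => ((edge_shape ty).1.1 < 8) &&
  ((edge_shape ty).2.1 < 8)) (iota 0 11) by [].
by apply; rewrite mem_iota.
Qed.

Lemma vertex_inj k r k' r' : k < 8 -> k' < 8 ->
  vertex k r = vertex k' r' -> k = k' /\ r = r'.
Proof. rewrite /vertex; lia. Qed.

Lemma position_lt x q : q < n * n -> 8 * position x q + 8 <= graph_order.
Proof.
move=> hq; rewrite graph_orderE.
have h1 : q %% n < n by rewrite ltn_mod.
have h2 : q %/ n <= q by apply: leq_div.
have h3 : n <= n * n by rewrite leq_pmulr.
case: x => [|[|[|[|[|x]]]]] /=; rewrite /position /=; try lia.
rewrite nth_nil; lia.
Qed.

Lemma src_lt e : valid e -> src e < graph_order.
Proof.
case/andP=> h1 h2; case/andP: (type_kinds h1) => k1 _.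
by have := position_lt (edge_shape e.1).1.2 h2; rewrite /src /vertex; lia.
Qed.

Lemma tgt_lt e : valid e -> tgt e < graph_order.
Proof.
case/andP=> h1 h2; case/andP: (type_kinds h1) => _ k1.
by have := position_lt (edge_shape e.1).2.2 h2; rewrite /tgt /vertex; lia.
Qed.

Lemma position_inj x y q q' : (x == 2) || ((x == 1) && (y == 0)) ->
  position x q = position x q' -> position y q = position y q' -> q = q'.
Proof.
case/orP => [/eqP -> //|/andP[/eqP-> /eqP->]]; rewrite /position /= => h1 h2.
by rewrite (divn_eq q n) (divn_eq q' n) h1 h2.
Qed.

(** Conditions on the table, decided by computation for all pairs of types, under which distinct
    codes give distinct undirected edges: endpoints of known type determine [q]; the ordered pair of
    kinds determines the type; edges inside one kind increase the position; only such edges could be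
    reverses of one another. *)
Definition shape_ok (ty ty' : nat) : bool :=
  let s := edge_shape ty in let s' := edge_shape ty' in
  [&& (s.1.2 == 2) || ((s.1.2 == 1) && (s.2.2 == 0)),
      (s.1.1 == s'.1.1) && (s.2.1 == s'.2.1) ==> (ty == ty'),
      (s.1.1 == s.2.1) ==> (s.1.2 == 2) && ((s.2.2 == 3) || (s.2.2 == 4))
    & (s.1.1 == s'.2.1) && (s.2.1 == s'.1.1) ==>
        (ty == ty') && (s.1.1 == s.2.1)].

Lemma shape_okP ty ty' : ty < 11 -> ty' < 11 -> shape_ok ty ty'.
Proof.
move=> h h'.
have /allP/(_ ty) : all (fun ty => all (shape_ok ty) (iota 0 11)) (iota 0 11)
  by vm_compute.
by rewrite mem_iota => /(_ h)/allP/(_ ty'); rewrite mem_iota; apply.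
Qed.

Lemma src_tgt_inj e e' : valid e -> valid e' ->
  src e = src e' -> tgt e = tgt e' -> e = e'.
Proof.
case: e e' => [ty q] [ty' q'] /andP[/= h _] /andP[/= h' _].
have /andP[a1 a2] := type_kinds h; have /andP[a1' a2'] := type_kinds h'.
rewrite /src /tgt /= => /(vertex_inj a1 a1')[e1 e2] /(vertex_inj a2 a2')[e3 e4].
case/and4P: (shape_okP h h') => xx; rewrite e1 e3 !eqxx /= => /eqP tt _ _.
by subst ty'; rewrite (position_inj xx e2 e4).
Qed.

Lemma position_succ x q : (x == 3) || (x == 4) -> position 2 q < position x q.
Proof. by case/orP=> /eqP ->; rewrite /position /=; lia. Qed.

(** Two mutually reversed edges would lie inside one kind, where each strictly increases the
    position; following both would return to the start. *)
Lemma src_tgt_neq e e' : valid e -> valid e' ->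
  src e = tgt e' -> tgt e = src e' -> False.
Proof.
case: e e' => [ty q] [ty' q'] /andP[/= h _] /andP[/= h' _].
have /andP[a1 a2] := type_kinds h; have /andP[a1' a2'] := type_kinds h'.
rewrite /src /tgt /= => /(vertex_inj a1 a2')[e1 e2] /(vertex_inj a2 a1')[e3 e4].
case/and4P: (shape_okP h h') => _ _ xx.
rewrite e1 e3 !eqxx /= => /andP[/eqP tt k12]; subst ty'.
move: xx; rewrite e1 eqxx => /andP[/eqP x2 xs]; move: e2 e4; rewrite x2 => e2 e4.
by have := position_succ q xs; have := position_succ q' xs; lia.
Qed.

Lemma src_neq_tgt e : valid e -> src e <> tgt e.
Proof. by move=> v h; apply: (@src_tgt_neq e e). Qed.

Lemma inord_eq x y : x < graph_order -> y < graph_order ->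
  (inord x == inord y :> 'I_graph_order) = (x == y).
Proof. by move=> hx hy; rewrite -val_eqE /= !inordK. Qed.

Lemma oedge_eq e e' : valid e -> valid e' -> (oedge e == oedge e') = (e == e').
Proof.
move=> v v'; apply/idP/idP => [|/eqP->//].
rewrite /oedge xpair_eqE !inord_eq ?src_lt ?tgt_lt // => /andP[/eqP h1 /eqP h2].
by apply/eqP/src_tgt_inj.
Qed.

Lemma oedge_flip e e' : valid e -> valid e' ->
  oedge e == ((oedge e').2, (oedge e').1) = false.
Proof.
move=> v v'; apply/negP.
rewrite /oedge xpair_eqE /= !inord_eq ?src_lt ?tgt_lt // => /andP[/eqP h1 /eqP h2].
exact: (src_tgt_neq v v').
Qed.

Lemma oedge_loopless e : valid e -> (oedge e).1 != (oedge e).2.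
Proof.
by move=> v; rewrite inord_eq ?src_lt ?tgt_lt //; apply/eqP/src_neq_tgt.
Qed.

Lemma adj_oedge L e : all valid L -> valid e ->
  adj (map oedge L) (oedge e).1 (oedge e).2 = (e \in L).
Proof.
move=> vL ve; rewrite /adj -surjective_pairing.
have -> : (((oedge e).2, (oedge e).1) \in map oedge L) = false.
  apply/negP => /mapP[e' /(allP vL) ve' h].
  by have := oedge_flip ve' ve; rewrite -h eqxx.
rewrite orbF; apply/mapP/idP => [[e' he' /eqP]|he]; last by exists e.
by rewrite oedge_eq //; [move=> /eqP -> | exact: allP vL _ he'].
Qed.

Lemma simple_graph_oedge L : all valid L -> uniq L -> simple_graph (map oedge L).
Proof.
elim: L => //= e L IH /andP[ve vL] /andP[eL uL].
have := IH vL uL; rewrite /simple_graph /= => /andP[-> ->]; rewrite oedge_loopless //.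
rewrite !andbT; apply/allP => f /mapP[e' he' ->] /=.
have ve' := allP vL _ he'; rewrite oedge_eq // oedge_flip // andbT.
by apply: contraNneq eL => ->.
Qed.

Lemma size_valid L : all valid L -> uniq L -> size L <= 11 * (n * n).
Proof.
move=> vL uL.
pose s := [seq (x, y) | x <- iota 0 11, y <- iota 0 (n * n)].
have -> : 11 * (n * n) = size s by rewrite size_allpairs !size_iota.
apply: uniq_leq_size uL _ => -[ty q] /(allP vL) /andP[/= h1 h2].
by apply/allpairsP; exists (ty, q); split; rewrite // mem_iota.
Qed.

(** * Updates as toggling of edge codes *)

Variable dir : direction.

Definition dec : bool := if dir is Decremental then true else false.

Definition toggle (L : seq code) (e : code) : seq code :=
  if dec then [seq e' <- L | e' != e] else rcons L e.

(* An edge is toggled when it has been updated, i.e. inserted (deleted) in the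
   incremental (decremental) problem. *)
Definition toggled (L : seq code) (e : code) : bool := (e \in L) (+) dec.

Lemma toggled_toggle L e e' :
  toggled (toggle L e) e' = (e' == e) || toggled L e'.
Proof.
rewrite /toggled /toggle; case: dec.
  by rewrite mem_filter; case: eqP.
by rewrite !addbF mem_rcons in_cons.
Qed.

Lemma mem_toggled L e : (e \in L) = toggled L e (+) dec.
Proof. by rewrite /toggled addbK. Qed.

Lemma valid_toggle L e : all valid L -> valid e -> all valid (toggle L e).
Proof.
rewrite /toggle => vL ve; case: dec; last by rewrite all_rcons ve.
by apply/allP=> x; rewrite mem_filter => /andP[_ /(allP vL)].
Qed.

Lemma uniq_toggle L e : uniq L -> ~~ toggled L e -> uniq (toggle L e).
Proof.
rewrite /toggle /toggled; case: dec => uL; first by rewrite filter_uniq.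
by rewrite addbF rcons_uniq uL => ->.
Qed.

Lemma update_oedge L e : all valid L -> valid e ->
  update dir (map oedge L) (oedge e).1 (oedge e).2 = map oedge (toggle L e).
Proof.
rewrite /update /toggle /dec -surjective_pairing => vL ve.
case: dir; first by rewrite map_rcons.
rewrite filter_map; congr map; apply: eq_in_filter => x /(allP vL) vx /=.
by rewrite oedge_eq // oedge_flip // andbT.
Qed.

Lemma legal_update_oedge L e : all valid L -> valid e -> ~~ toggled L e ->
  legal_update dir (map oedge L) (oedge e).1 (oedge e).2.
Proof.
move=> vL ve; rewrite /legal_update /toggled /dec adj_oedge //.
by case: dir; rewrite ?addbF ?addbT ?negbK // => ->; rewrite oedge_loopless.
Qed.

(* Queries carry the position q at which they are posed. *)
Inductive areq : Type := AUpd of code | AQry of nat.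

Definition creq (o : areq) : request graph_order :=
  match o with
  | AUpd e => Update (oedge e).1 (oedge e).2
  | AQry _ => Query
  end.

Definition after (L : seq code) (os : seq areq) : seq code :=
  foldl (fun L o => if o is AUpd e then toggle L e else L) L os.

(** The parameter [G] is what the graph must satisfy when a query is posed: [True] where only
    legality matters, [ready] where answers have to be interpreted. *)
Fixpoint admissible (G : seq code -> nat -> Prop) (L : seq code) (os : seq areq)
    : Prop :=
  match os with
  | [::] => True
  | AUpd e :: os' => [/\ valid e, ~~ toggled L e & admissible G (toggle L e) os']
  | AQry q :: os' => G L q /\ admissible G L os'
  end.

Lemma admissible_cat G L os1 os2 :
  admissible G L (os1 ++ os2) <->
  admissible G L os1 /\ admissible G (after L os1) os2.
Proof.
elim: os1 L => [|[e|q] os IH] L /=; first by split=> [|[]].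
  split=> [[h1 h2 /IH[h3 h4]]//|[[h1 h2 h3] h4]]; split=> //; exact/IH.
by split=> [[h1 /IH[h3 h4]]//|[[h1 h3] h4]]; split=> //; apply/IH.
Qed.

Lemma after_cat L os1 os2 : after L (os1 ++ os2) = after (after L os1) os2.
Proof. exact: foldl_cat. Qed.

Lemma admissible_legal G L os m : 11 * (n * n) <= m ->
  all valid L -> uniq L -> admissible G L os ->
  legal dir m (map oedge L) (map creq os).
Proof.
move=> hm; elim: os L => [|[e|q] os IH] L vL uL; rewrite [map _ _]/= [legal _ _ _ _]/=.
- by rewrite andbT size_map (leq_trans _ hm) ?size_valid.
- case=> ve te h; rewrite size_map (leq_trans _ hm) ?size_valid //=.
  by rewrite legal_update_oedge // update_oedge // IH ?valid_toggle ?uniq_toggle.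
- by case=> _ h; rewrite size_map (leq_trans _ hm) ?size_valid //= IH.
Qed.

Lemma correct_answers_cat s t L os1 os2 rs1 rs2 G :
  all valid L -> uniq L -> admissible G L os1 -> size rs1 = size os1 ->
  correct_answers dir s t (map oedge L) (map creq (os1 ++ os2)) (rs1 ++ rs2) ->
  correct_answers dir s t (map oedge L) (map creq os1) rs1 /\
  correct_answers dir s t (map oedge (after L os1)) (map creq os2) rs2.
Proof.
elim: os1 L rs1 => [|[e|q] os IH] L [|r rs1] //= vL uL.
  case=> ve te h [] sz; rewrite !update_oedge //.
  by apply: IH; rewrite ?valid_toggle ?uniq_toggle.
by case=> g h [] sz [d /(IH _ _ vL uL h sz)[]].
Qed.

End GadgetGraph.

(** * Distances in the gadget graph *)

Section GadgetDistance.
Set Implicit Arguments.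
Unset Strict Implicit.
Local Open Scope nat_scope.

Variable n : nat.
Hypothesis n_gt0 : 0 < n.
(* The matrix is flattened: entry (i, j) is [A (i * n + j)]. *)
Variables A v w : nat -> bool.

Definition two_steps (i k : nat) : bool :=
  has (fun j => [&& A (i * n + j), v j & A (j * n + k)]) (iota 0 n).

Definition three_steps (i l : nat) : bool :=
  has (fun k => [&& two_steps i k, w k & A (k * n + l)]) (iota 0 n).

Definition triangle (i : nat) : bool := three_steps i i.

(** Length of the intended walk: [q] steps on each of the S and T paths, [c = q / n] steps on an X
    path and on a Y path, and seven further edges through a, x, y and d. *)
Definition threshold (q : nat) : nat := 2 * (q + q %/ n) + 7.

(** For types 9 and 10: edges from other phases may only sit at larger [c], where using them costs
    more, while the edges of the current phase spell out the vector. *)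
Definition slot_ready (L : seq code) (q ty : nat) (x : nat -> bool) : Prop :=
  forall q', q' < n * n ->
    ((ty, q') \in L -> q %/ n <= q' %/ n) /\
    (q' %/ n = q %/ n -> ((ty, q') \in L) = x (q' %% n)).

Definition attached (L : seq code) (q ty : nat) : Prop :=
  (ty, q) \in L /\ forall q', (ty, q') \in L -> q <= q'.

Definition ready (L : seq code) (q : nat) : Prop :=
  [/\ q < n * n, all (valid n) L,
      forall ty q', ty < 7 -> q' < n * n -> ((ty, q') \in L) = (ty < 4) || A q',
      attached L q 7 /\ attached L q 8
    & slot_ready L q 9 v /\ slot_ready L q 10 w].

(** * Lower bound on the distance in the absence of a triangle *)

Section Potential.
Variables (L : seq code) (Q : nat).
Hypotheses (rdy : ready L Q) (no_triangle : ~~ triangle (Q %% n)).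

Let c := Q %/ n.
Let i0 := Q %% n.

(* A 1-Lipschitz lower bound for the distance from s; at each layer it is one
   more on the vertices that no tight path starting with i0 reaches. *)
Definition potential (x : nat) : nat :=
  let r := x %/ 8 in
  match x %% 8 with
  | 0 => minn r Q.+1
  | 2 => minn (Q + 2 + r %/ n + ~~ A (i0 * n + r %% n)) (Q + 3 + c)
  | 3 => minn (Q + 4 + c + r %/ n + ~~ two_steps i0 (r %% n)) (Q + 5 + 2 * c)
  | 4 => Q + 1 + (r != i0)
  | 5 => Q + 6 + 2 * c + ~~ three_steps i0 r
  | 6 => Q + 3 + c + ~~ (A (i0 * n + r) && v r)
  | 7 => Q + 5 + 2 * c + ~~ (two_steps i0 r && w r)
  | _ => Q + 7 + 2 * c + (Q.+1 - r)
  end.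

Definition near (a b : nat) : bool := (a <= b.+1) && (b <= a.+1).

Lemma vertexK k r : k < 8 -> (vertex k r %% 8 = k) * (vertex k r %/ 8 = r).
Proof. by rewrite /vertex => h; split; lia. Qed.

(** The caps in the potential absorb the dynamic edges beyond the current ones. The absence of a
    triangle enters only at the edge between T_Q and d_i0, which would otherwise jump by two. *)
Lemma potential_edge e : e \in L -> near (potential (src n e)) (potential (tgt n e)).
Proof.
case: rdy => hQ vL hst [[_ h7] [_ h8]] [h9 h10] he.
have /andP[] := allP vL _ he; case: e he => ty q /= he hty hq.
have Hi : q %% n < n by rewrite ltn_mod.
have Hc : q %/ n < n by rewrite ltn_divLR.
have Ei : q %% n %% n = q %% n by rewrite modn_small.
have Ec : q %% n %/ n = 0 by rewrite divn_small.
have Eq := divn_eq q n.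
rewrite /near /potential /src /tgt /edge_shape.
do 11?[case: ty hty he => [|ty] hty he //=]; rewrite !vertexK //= /position /=.
- by lia.
- by lia.
- by rewrite divnDr // divnn n_gt0 modnDr; lia.
- by rewrite divnDr // divnn n_gt0 modnDr; lia.
(* Types 4 to 6: an edge could violate the bound only if it starts on a tight path from [i0], and
   then it ends on one too. *)
- rewrite Ei Ec; have := hst 4 q isT hq; rewrite he /= => /esym Aq.
  case: eqP => [<-|_]; last by lia.
  by rewrite -Eq Aq; lia.
- rewrite Ei Ec; have := hst 5 q isT hq; rewrite he /= => /esym Aq.
  case: (boolP (A (i0 * n + q %/ n) && v (q %/ n))) => [h|_]; last by lia.
  suff -> : two_steps i0 (q %% n) by lia.
  apply/hasP; exists (q %/ n); first by rewrite mem_iota.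
  by rewrite -Eq Aq !andbT.
- have := hst 6 q isT hq; rewrite he /= => /esym Aq.
  case: (boolP (two_steps i0 (q %/ n) && w (q %/ n))) => [h|_]; last by lia.
  suff -> : three_steps i0 (q %% n) by lia.
  apply/hasP; exists (q %/ n); first by rewrite mem_iota.
  by rewrite -Eq Aq !andbT.
(* Types 7 and 8: for [q] other than [Q] the edge lies beyond [Q], where the S and T terms are
   constant. *)
- have := h7 q he; case: (eqVneq q Q) => [->|]; last by lia.
  by rewrite eqxx; lia.
- have := h8 q he; case: (eqVneq q Q) => [->|]; last by lia.
  by rewrite -/(triangle _) (negPf no_triangle); lia.
(* Types 9 and 10: in the current phase the edge certifies a set bit of the vector; for larger [c]
   the cap applies. *)
- case: (h9 q hq) => /(_ he) le_c eq_c.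
  case: (eqVneq (q %/ n) (Q %/ n)) => [E|/eqP NE]; last by rewrite -/c in le_c NE *; lia.
  by have := eq_c E; rewrite he => <-; rewrite andbT E -/c; lia.
- case: (h10 q hq) => /(_ he) le_c eq_c.
  case: (eqVneq (q %/ n) (Q %/ n)) => [E|/eqP NE]; last by rewrite -/c in le_c NE *; lia.
  by have := eq_c E; rewrite he => <-; rewrite andbT E -/c; lia.
Qed.

Lemma potential_path (x : 'I_(graph_order n)) p :
  path (adj (map (oedge n) L)) x p ->
  potential (last x p) <= potential x + size p.
Proof.
case: rdy => _ vL _ _ _.
elim: p x => [|y p IH] x /=; first by rewrite addn0.
case/andP=> xy /IH h.
suff : near (potential x) (potential y) by case/andP=> _; lia.
have val_edge e : e \in L ->
    near (potential (oedge n e).1) (potential (oedge n e).2).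
  move=> he; have ve := allP vL _ he.
  by rewrite /oedge !inordK ?src_lt ?tgt_lt //; apply: potential_edge.
case/orP: xy => /mapP[e /val_edge + ee]; rewrite -ee //=.
by rewrite /near andbC.
Qed.

End Potential.

(** * Upper bound on the distance from a triangle *)

Section Walk.
Variables (L : seq code) (Q : nat).
Hypotheses (rdy : ready L Q).

Let reach (x y l : nat) : Prop :=
  exists2 p, path (adj (map (oedge n) L)) (inord x) p
    & last (inord x) p = inord y /\ size p = l.

Let reach_trans x y z l l' : reach x y l -> reach y z l' -> reach x z (l + l').
Proof.
case=> p h1 [h2 h3] [p' h1' [h2' h3']]; exists (p ++ p').
  by rewrite cat_path h1 h2.
by rewrite last_cat h2 size_cat h3 h3'.
Qed.

Let reach_fwd e : e \in L -> reach (src n e) (tgt n e) 1.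
Proof.
move=> he; exists [:: inord (tgt n e)] => //=; rewrite andbT.
by apply/orP; left; apply/mapP; exists e.
Qed.

Let reach_bwd e : e \in L -> reach (tgt n e) (src n e) 1.
Proof.
move=> he; exists [:: inord (src n e)] => //=; rewrite andbT.
by apply/orP; right; apply/mapP; exists e.
Qed.

Let reach_chain (f : nat -> nat) m :
  (forall k, k < m -> reach (f k) (f k.+1) 1) -> reach (f 0) (f m) m.
Proof.
elim: m => [|m IH] h; first by exists [::].
rewrite -[m.+1 in X in reach _ _ X]addn1; apply: reach_trans (h m _) => //.
by apply: IH => k hk; apply: h; lia.
Qed.

Let reach_chain_rev (f : nat -> nat) m :
  (forall k, k < m -> reach (f k.+1) (f k) 1) -> reach (f m) (f 0) m.
Proof.
elim: m => [|m IH] h; first by exists [::].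
rewrite -[m.+1 in X in reach _ _ X]add1n; apply: reach_trans (h m _) _ => //.
by apply: IH => k hk; apply: h; lia.
Qed.

Lemma walk_of_triangle : triangle (Q %% n) ->
  exists2 p, is_walk (map (oedge n) L) (inord 0) (inord 1) p
    & size p = threshold Q.
Proof.
case: rdy => hQ vL hst [[h7 _] [h8 _]] [h9 h10].
case/hasP=> k; rewrite mem_iota /= add0n => hk /and3P[/hasP[j]].
rewrite mem_iota /= add0n => hj /and3P[Aij vj Ajk] wk Aki.
set i := Q %% n in Aij Aki; set c := Q %/ n.
have hi : i < n by rewrite ltn_mod.
have hc : c < n by rewrite ltn_divLR.
have sq x y : x < n -> y < n -> x * n + y < n * n.
  by move=> hx hy; nia.
have modE x y : y < n -> (x * n + y) %% n = y.
  by move=> hy; rewrite modnMDl modn_small.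
have divE x y : y < n -> (x * n + y) %/ n = x.
  by move=> hy; rewrite divnMDl // divn_small // addn0.
(* The pieces [S1] to [S11] visit the kinds S, a, X, x, Y, y, d, T in this order; their lengths add
   up to [threshold Q]. *)
have S1 : reach (vertex 0 0) (vertex 0 Q) Q.
  apply: (@reach_chain (vertex 0)) => q hq; apply: (@reach_fwd (0, q)).
  by rewrite hst // (leq_trans hq) // ltnW.
have S2 : reach (vertex 0 Q) (vertex 4 i) 1 by apply: (@reach_fwd (7, Q)).
have S3 : reach (vertex 4 i) (vertex 2 j) 1.
  have := @reach_fwd (4, i * n + j); rewrite /src /tgt /= /position /= divE // modE //.
  by apply; rewrite hst ?sq.
have S4 : reach (vertex 2 j) (vertex 2 (c * n + j)) c.
  apply: (@reach_chain (fun k => vertex 2 (k * n + j))) => q hq.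
  have -> : q.+1 * n + j = q * n + j + n by lia.
  by apply: (@reach_fwd (2, q * n + j)); rewrite hst // sq //; lia.
have S5 : reach (vertex 2 (c * n + j)) (vertex 6 j) 1.
  have := @reach_fwd (9, c * n + j); rewrite /src /tgt /= /position /= modE //.
  by apply; case: (h9 (c * n + j) (sq _ _ hc hj)) => _ -> //; rewrite ?divE ?modE.
have S6 : reach (vertex 6 j) (vertex 3 k) 1.
  have := @reach_fwd (5, j * n + k); rewrite /src /tgt /= /position /= divE // modE //.
  by apply; rewrite hst ?sq.
have S7 : reach (vertex 3 k) (vertex 3 (c * n + k)) c.
  apply: (@reach_chain (fun q => vertex 3 (q * n + k))) => q hq.
  have -> : q.+1 * n + k = q * n + k + n by lia.
  by apply: (@reach_fwd (3, q * n + k)); rewrite hst // sq //; lia.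
have S8 : reach (vertex 3 (c * n + k)) (vertex 7 k) 1.
  have := @reach_fwd (10, c * n + k); rewrite /src /tgt /= /position /= modE //.
  by apply; case: (h10 (c * n + k) (sq _ _ hc hk)) => _ -> //; rewrite ?divE ?modE.
have S9 : reach (vertex 7 k) (vertex 5 i) 1.
  have := @reach_fwd (6, k * n + i); rewrite /src /tgt /= /position /= divE // modE //.
  by apply; rewrite hst ?sq.
have S10 : reach (vertex 5 i) (vertex 1 Q) 1 by apply: (@reach_bwd (8, Q)).
have S11 : reach (vertex 1 Q) (vertex 1 0) Q.
  apply: (@reach_chain_rev (vertex 1)) => q hq; apply: (@reach_bwd (1, q)).
  by rewrite hst // (leq_trans hq) // ltnW.
case: (reach_trans S1 (reach_trans S2 (reach_trans S3 (reach_trans S4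
  (reach_trans S5 (reach_trans S6 (reach_trans S7 (reach_trans S8
  (reach_trans S9 (reach_trans S10 S11)))))))))) => p hp [lp sp].
by exists p => //; rewrite sp /threshold -/c; lia.
Qed.

End Walk.

Lemma distance_triangle L q r : ready L q ->
  is_distance (map (oedge n) L) (inord 0) (inord 1) r ->
  (r <= threshold q) = triangle (q %% n).
Proof.
move=> rdy dist; have [hq _ _ _ _] := rdy.
(* The order of the graph stands for an infinite distance, so it has to exceed the threshold. *)
have Ht : threshold q < graph_order n.
  have : q %/ n <= q by apply: leq_div.
  have : n <= n * n by rewrite leq_pmulr.
  by rewrite graph_orderE // /threshold; lia.
apply/idP/idP => [hr|tr]; last first.
  have [p hp sp] := walk_of_triangle rdy tr.
  by case: dist => [[_ /(_ _ hp)]|[/(_ p)//]]; rewrite sp.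
apply: contraLR hr => ntr; rewrite -ltnNge.
case: dist => [[[p [hp lp] <-] _]|[_ -> //]].
(* The potential is 0 at S_0 and [threshold q + 1] at T_0, so every walk is longer than the
   threshold. *)
have := potential_path rdy ntr hp; rewrite lp !inordK //; last first.
  by apply: (leq_ltn_trans _ Ht); rewrite /threshold addnS.
by rewrite /potential /threshold /=; lia.
Qed.

End GadgetDistance.

(** * The schedule of updates and queries *)

Section Schedule.
Set Implicit Arguments.
Unset Strict Implicit.
Local Open Scope nat_scope.

Variable n : nat.
Variable dir : direction.
Local Notation dec := (dec dir).

(* Position handled at time k, and conversely: positions are visited in
   increasing (decreasing) order in the decremental (incremental) problem. *)
Definition clock (q : nat) : nat := if dec then q else n * n - q - 1.

Lemma clock_lt q : q < n * n -> clock q < n * n.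
Proof. by rewrite /clock; case: dec; lia. Qed.

Lemma clockK q : q < n * n -> clock (clock q) = q.
Proof. by rewrite /clock; case: dec; lia. Qed.

Lemma clock_eq q q' : q < n * n -> q' < n * n ->
  (clock q == clock q') = (q == q').
Proof. by rewrite /clock; case: dec; lia. Qed.

Hypothesis n_gt0 : 0 < n.

(** A small language for loop bodies with two readings, as requests in [item_reqs] and as machine
    code in [item_cmd], so that schedule and program have the same structure. *)
Inductive item : Type := IUpd of nat | IGuard of nat & bool & nat | ITest.

Definition item_reqs (bits : nat -> nat -> bool) (it : item) (q : nat)
    : seq areq :=
  match it with
  | IUpd ty => [:: AUpd (ty, q)]
  | IGuard a b ty => if bits a (q %% n) == b then [:: AUpd (ty, q)] else [::]
  | ITest => [:: AQry q]
  end.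

Definition body_reqs bits (its : seq item) (q : nat) : seq areq :=
  flatten [seq item_reqs bits it q | it <- its].

Lemma body_reqs_cons bits it its q :
  body_reqs bits (it :: its) q = item_reqs bits it q ++ body_reqs bits its q.
Proof. by []. Qed.

Lemma body_reqs1 bits it q : body_reqs bits [:: it] q = item_reqs bits it q.
Proof. exact: cats0. Qed.

Definition loop_reqs bits its (b m : nat) : seq areq :=
  flatten [seq body_reqs bits its (clock k) | k <- iota b m].

(** Insertions realise the ones of the vectors; deletions, starting from all edges, remove the
    zeros. *)
Definition pre_items : seq item := [:: IGuard 2 (~~ dec) 9; IGuard 3 (~~ dec) 10].
(** The closest dynamic edge is the one just inserted, or the next one to be deleted; hence the test
    comes last or first. *)
Definition main_items : seq item :=
  if dec then [:: ITest; IUpd 7; IUpd 8] else [:: IUpd 7; IUpd 8; ITest].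
(** Under deletions [c] grows, so edges left over from a phase would be too close for the later
    ones. Under insertions they are farther away and may stay. *)
Definition post_items : seq item :=
  if dec then [:: IGuard 2 true 9; IGuard 3 true 10] else [::].

Definition phase_reqs bits (ph : nat) : seq areq :=
  loop_reqs bits pre_items (ph * n) n ++
  (loop_reqs bits main_items (ph * n) n ++ loop_reqs bits post_items (ph * n) n).

(* At times below p everything is over, at times in [p, k) the edges of type ty
   reflect the bits x, and at times from k on they are still in their initial
   state. *)
Definition slot (L : seq code) (ty : nat) (x : nat -> bool) (p k : nat) : Prop :=
  forall q, q < n * n ->
    if clock q < p then dec ==> toggled dir L (ty, q)
    else toggled dir L (ty, q) == (clock q < k) && (x (q %% n) (+) dec).

Lemma slot_other L ty ty' q x p k : ty != ty' ->
  slot L ty x p k -> slot (toggle dir L (ty', q)) ty x p k.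
Proof.
move=> ne h q' /h; rewrite toggled_toggle xpair_eqE (negPf ne) /=.
by case: ifP.
Qed.

(** A bit that differs from [dec] calls for a toggle; any other bit agrees with the initial state of
    the edge. *)
Lemma slot_advance L ty x p q : q < n * n -> p <= clock q ->
  slot L ty x p (clock q) ->
  ~~ toggled dir L (ty, q) /\
  slot (if x (q %% n) == ~~ dec then toggle dir L (ty, q) else L) ty x p (clock q).+1.
Proof.
move=> hq hp h; split; first by have := h q hq; rewrite ltnNge hp ltnn /= => /eqP ->.
move=> q' hq'; have := h q' hq'; rewrite ltnS [clock q' <= clock q]leq_eqVlt clock_eq //.
have [->|ne] := eqVneq q' q.
  rewrite ltnNge hp ltnn /= => /eqP h0; case: ifP => hx.
    by rewrite toggled_toggle eqxx /= (eqP hx); case: dec.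
  by rewrite h0; move: hx; case: (x _); case: dec.
rewrite /=; case: (x (q %% n) == _) => //; rewrite toggled_toggle xpair_eqE (negPf ne) andbF //.
Qed.

(** Within the window [[p, k)] an edge has been deleted exactly when its bit is zero, so the edges
    to delete now are those with bit one. *)
Lemma slot_release L ty x k q : q < n * n -> dec -> clock q < k ->
  slot L ty x (clock q) k ->
  (x (q %% n) -> ~~ toggled dir L (ty, q)) /\
  slot (if x (q %% n) == true then toggle dir L (ty, q) else L) ty x (clock q).+1 k.
Proof.
move=> hq hd hk h.
have hqt : toggled dir L (ty, q) = ~~ x (q %% n).
  by have := h q hq; rewrite ltnn hk hd addbT => /eqP.
split; first by rewrite hqt negbK.
move=> q' hq'; have := h q' hq'; rewrite ltnS [clock q' <= clock q]leq_eqVlt clock_eq //.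
have [->|ne] := eqVneq q' q.
  rewrite ltnn hd /= => _; case: ifP => hx; first by rewrite toggled_toggle eqxx.
  by rewrite hqt; case: (x _) hx.
rewrite /=; case: (x (q %% n) == true) => //; rewrite toggled_toggle xpair_eqE (negPf ne) andbF //.
Qed.

Variables (A : nat -> bool) (bits : nat -> nat -> bool).

(** Invariant of the schedule. Every bound is a separate parameter because the updates of a phase
    move them one at a time. With the constant bit [~~ dec], types 7 and 8 are toggled at exactly
    the times below their bound. *)
Record sched (L : seq code) (p9 k9 p10 k10 k7 k8 : nat) : Prop := Sched {
  sched_valid : all (valid n) L;
  sched_uniq : uniq L;
  sched_static : forall ty q, ty < 7 -> q < n * n ->
    ((ty, q) \in L) = (ty < 4) || A q;
  sched9 : slot L 9 (bits 2) p9 k9;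
  sched10 : slot L 10 (bits 3) p10 k10;
  sched7 : slot L 7 (fun=> ~~ dec) 0 k7;
  sched8 : slot L 8 (fun=> ~~ dec) 0 k8 }.

Lemma sched_toggle L p9 k9 p10 k10 k7 k8 ty q :
  sched L p9 k9 p10 k10 k7 k8 -> 7 <= ty < 11 -> q < n * n ->
  ~~ toggled dir L (ty, q) ->
  let L' := toggle dir L (ty, q) in
  [/\ all (valid n) L', uniq L' & forall ty q, ty < 7 -> q < n * n ->
    ((ty, q) \in L') = (ty < 4) || A q].
Proof.
case=> hv hu hs _ _ _ _ /andP[t1 t2] hq ht; split.
- by rewrite valid_toggle // /valid /= t2.
- exact: uniq_toggle.
- move=> ty' q' h1 h2; rewrite (mem_toggled dir) toggled_toggle xpair_eqE.
  have -> : (ty' == ty) = false by lia.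
  by rewrite /= -(mem_toggled dir) hs.
Qed.

Variable G : seq code -> nat -> Prop.

(** A Hoare triple for lists of requests, composed by [achieves_cat] and iterated by
    [achieves_loop]. *)
Definition achieves L os (P : seq code -> Prop) : Prop :=
  admissible n dir G L os /\ P (after dir L os).

Lemma achieves_cat L os1 os2 (P Q : seq code -> Prop) : achieves L os1 P ->
  (forall L', P L' -> achieves L' os2 Q) -> achieves L (os1 ++ os2) Q.
Proof.
case=> h1 h2 h; have [h3 h4] := h _ h2.
by split; rewrite ?after_cat // admissible_cat.
Qed.

Lemma achieves_loop its (I : nat -> seq code -> Prop) b m L :
  (forall k L, b <= k < b + m -> I k L ->
    achieves L (body_reqs bits its (clock k)) (I k.+1)) ->
  I b L -> achieves L (loop_reqs bits its b m) (I (b + m)).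
Proof.
elim: m b L => [|m IH] b L h h0; first by rewrite addn0.
apply: (@achieves_cat _ _ _ (I b.+1)).
  by apply: h h0; lia.
move=> L' h'; rewrite addnS -addSn; apply: IH h'.
by move=> k L1 hk; apply: h; lia.
Qed.

Lemma guard9 L k p10 k10 k7 k8 p9 q : q < n * n -> k = clock q -> p9 <= k ->
  sched L p9 k p10 k10 k7 k8 ->
  achieves L (item_reqs bits (IGuard 2 (~~ dec) 9) q)
    (fun L' => sched L' p9 k.+1 p10 k10 k7 k8).
Proof.
move=> hq -> hp S; have [t s] := slot_advance hq hp (sched9 S).
rewrite /item_reqs; case: ifP s => hx s; last by split=> //; case: S s.
have [s1 s2 s3] := @sched_toggle _ _ _ _ _ _ _ 9 q S isT hq t.
split; first by split=> //; rewrite /valid /= hq.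
by case: S => _ _ _ S9 S10 S7 S8; split=> //; apply: slot_other.
Qed.

Lemma guard10 L k p10 k9 k7 k8 p9 q : q < n * n -> k = clock q -> p10 <= k ->
  sched L p9 k9 p10 k k7 k8 ->
  achieves L (item_reqs bits (IGuard 3 (~~ dec) 10) q)
    (fun L' => sched L' p9 k9 p10 k.+1 k7 k8).
Proof.
move=> hq -> hp S; have [t s] := slot_advance hq hp (sched10 S).
rewrite /item_reqs; case: ifP s => hx s; last by split=> //; case: S s.
have [s1 s2 s3] := @sched_toggle _ _ _ _ _ _ _ 10 q S isT hq t.
split; first by split=> //; rewrite /valid /= hq.
by case: S => _ _ _ S9 S10 S7 S8; split=> //; apply: slot_other.
Qed.

Lemma update7 L k p10 k9 k10 k8 p9 q : q < n * n -> k = clock q ->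
  sched L p9 k9 p10 k10 k k8 ->
  achieves L (item_reqs bits (IUpd 7) q)
    (fun L' => sched L' p9 k9 p10 k10 k.+1 k8).
Proof.
move=> hq -> S; have [t] := slot_advance hq (leq0n _) (sched7 S).
rewrite eqxx => s; have [s1 s2 s3] := @sched_toggle _ _ _ _ _ _ _ 7 q S isT hq t.
split; first by split=> //; rewrite /valid /= hq.
by case: S => _ _ _ S9 S10 S7 S8; split=> //; apply: slot_other.
Qed.

Lemma update8 L k p10 k9 k10 k7 p9 q : q < n * n -> k = clock q ->
  sched L p9 k9 p10 k10 k7 k ->
  achieves L (item_reqs bits (IUpd 8) q)
    (fun L' => sched L' p9 k9 p10 k10 k7 k.+1).
Proof.
move=> hq -> S; have [t] := slot_advance hq (leq0n _) (sched8 S).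
rewrite eqxx => s; have [s1 s2 s3] := @sched_toggle _ _ _ _ _ _ _ 8 q S isT hq t.
split; first by split=> //; rewrite /valid /= hq.
by case: S => _ _ _ S9 S10 S7 S8; split=> //; apply: slot_other.
Qed.

Lemma release9 L k p10 k10 k7 k8 p9 q : q < n * n -> dec -> p9 = clock q ->
  p9 < k -> sched L p9 k p10 k10 k7 k8 ->
  achieves L (item_reqs bits (IGuard 2 true 9) q)
    (fun L' => sched L' p9.+1 k p10 k10 k7 k8).
Proof.
move=> hq hd -> hp S; have [t s] := slot_release hq hd hp (sched9 S).
rewrite /item_reqs; case: ifP s => hx s; last by split=> //; case: S s.
have [s1 s2 s3] := @sched_toggle _ _ _ _ _ _ _ 9 q S isT hq (t (eqP hx)).
split; first by split; rewrite ?t ?(eqP hx) // /valid /= hq.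
by case: S => _ _ _ S9 S10 S7 S8; split=> //; apply: slot_other.
Qed.

Lemma release10 L k p10 k9 k7 k8 p9 q : q < n * n -> dec -> p10 = clock q ->
  p10 < k -> sched L p9 k9 p10 k k7 k8 ->
  achieves L (item_reqs bits (IGuard 3 true 10) q)
    (fun L' => sched L' p9 k9 p10.+1 k k7 k8).
Proof.
move=> hq hd -> hp S; have [t s] := slot_release hq hd hp (sched10 S).
rewrite /item_reqs; case: ifP s => hx s; last by split=> //; case: S s.
have [s1 s2 s3] := @sched_toggle _ _ _ _ _ _ _ 10 q S isT hq (t (eqP hx)).
split; first by split; rewrite ?t ?(eqP hx) // /valid /= hq.
by case: S => _ _ _ S9 S10 S7 S8; split=> //; apply: slot_other.
Qed.

(** A phase occupies one block of positions, with [c = ph] under deletions and [c = n - ph - 1]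
    under insertions; smaller [c] means earlier times in the first case and later times in the
    second. *)
Lemma phase_position ph : ph < n -> exists2 c, c < n & forall q, q < n * n ->
  (ph * n <= clock q < ph * n + n) = (q %/ n == c) /\
  (q %/ n < c) = (if dec then clock q < ph * n else ph * n + n <= clock q).
Proof.
move=> hph; set c := if dec then ph else n - ph - 1.
have hc : c < n by rewrite /c; case: dec; lia.
exists c => // q hq.
have E : (q %/ n == c) = (c * n <= q < c * n + n).
  by rewrite eqn_leq andbC leq_divRL // -[_ %/ _ <= c]ltnS ltn_divLR // mulSn addnC.
rewrite {}E ltn_divLR // /clock; move: @c hc; case: dec => c hc; first by split.
have -> : c * n = n * n - ph * n - n by rewrite /c !mulnBl mul1n.
have : ph * n + n <= n * n by rewrite -mulSnr leq_mul2r hph orbT.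
by split; lia.
Qed.

(** At the test for [q] the edges of types 7 and 8 present are those at positions from [q] on. The
    summand [~~ dec] reflects that the edge at [q] is inserted before its test but deleted after
    it. *)
Lemma sched_ready L ph q : ph < n -> q < n * n ->
  let b := ph * n in
  b <= clock q < b + n -> let k := clock q + ~~ dec in
  sched L b (b + n) b (b + n) k k -> ready n A (bits 2) (bits 3) L q.
Proof.
move=> hph hq b hb k [hv hu hs S9 S10 S7 S8].
have [c _ hc] := phase_position hph.
have qc : q %/ n = c by apply/eqP; case: (hc q hq) => <-.
have att ty : slot L ty (fun=> ~~ dec) 0 k -> attached L q ty.
  move=> S.
  have M q' : q' < n * n -> ((ty, q') \in L) = (q <= q').
    move=> hq'; rewrite (mem_toggled dir); have := S q' hq'; rewrite ltn0 => /eqP ->.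
    by rewrite /k /clock; move: hq hq'; case: dec => /= ? ?; lia.
  split; first by rewrite M.
  move=> q' hq'; rewrite -M //.
  by have /andP[] := allP hv _ hq'.
have slt ty x : slot L ty x b (b + n) -> slot_ready n L q ty x.
  move=> S q' hq'; have S0 := S q' hq'; have [h1 h2] := hc q' hq'.
  rewrite qc (mem_toggled dir); move: S0 h1 h2; rewrite -/b.
  case: dec => /= S0 h1 h2; (split=> [hL|/eqP]; last first).
  - rewrite -h1 => /andP[h3 h4]; move: S0; rewrite ltnNge h3 h4 /= => /eqP ->.
    by rewrite addbK.
  - by rewrite leqNgt h2; case: ifP S0 => // _ tog; rewrite tog in hL.
  - rewrite -h1 => /andP[h3 h4]; move: S0; rewrite ltnNge h3 h4 /= => /eqP ->.
    by rewrite addbK.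
  - rewrite leqNgt h2 -ltnNge; case: ifP S0 => [h3 _|_]; first by lia.
    by move: hL; rewrite addbF => -> /eqP/esym/andP[].
by split=> //; split; [exact: att|exact: att|exact: slt|exact: slt].
Qed.

Lemma phase_achieves ph L : ph < n ->
  (forall L q, ready n A (bits 2) (bits 3) L q -> G L q) ->
  let b := ph * n in sched L b b b b b b ->
  let b' := ph.+1 * n in
  achieves L (phase_reqs bits ph) (fun L' => sched L' b' b' b' b' b' b').
Proof.
move=> hph hG b S b'.
have b'E : b' = b + n by rewrite /b' mulSn addnC.
have b'n : b' <= n * n by rewrite leq_mul2r hph orbT.
have clk k : b <= k < b + n -> clock k < n * n /\ k = clock (clock k).
  by move=> hk; rewrite clockK ?clock_lt //; lia.
apply: (@achieves_cat _ _ _ (fun L => sched L b b' b b' b b)).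
  rewrite b'E; apply: (@achieves_loop _ (fun k L => sched L b k b k b b)) => // k {}L hk {}S.
  have [hq ck] := clk k hk; rewrite body_reqs_cons body_reqs1.
  apply: achieves_cat (guard9 hq ck _ S) _; first by lia.
  by move=> L' S'; apply: guard10 S' => //; lia.
move=> {S}L S; apply: (@achieves_cat _ _ _ (fun L => sched L b b' b b' b' b')).
  have := @achieves_loop main_items (fun k L => sched L b b' b b' k k) b n L.
  rewrite -b'E; apply=> // k {}L hk {}S; rewrite b'E in hk.
  have [hq ck] := clk k hk; rewrite /main_items.
  have tst L1 : sched L1 b b' b b' (k + ~~ dec) (k + ~~ dec) ->
      achieves L1 (item_reqs bits ITest (clock k))
        (fun L' => sched L' b b' b b' (k + ~~ dec) (k + ~~ dec)).
    move=> S1; split=> //; split=> //; apply/hG/(@sched_ready _ ph) => //.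
      by rewrite -ck.
    by rewrite -ck -/b -b'E.
  move: tst; case: dec => tst; rewrite 2!body_reqs_cons body_reqs1.
    apply: achieves_cat (tst _ _) _; first by rewrite addn0.
    move=> L1; rewrite addn0 => S1; apply: achieves_cat (update7 hq ck S1) _.
    by move=> L2 S2; apply: update8 S2.
  apply: achieves_cat (update7 hq ck S) _ => L1 S1.
  apply: achieves_cat (update8 hq ck S1) _ => L2 S2.
  by move: tst; rewrite addn1; apply.
move=> {S}L S; rewrite /post_items; case D: dec.
  have := @achieves_loop [:: IGuard 2 true 9; IGuard 3 true 10]
    (fun k L => sched L k b' k b' b' b') b n L.
  rewrite -b'E; apply=> // k {}L hk {}S; rewrite b'E in hk.
  have [hq ck] := clk k hk; rewrite body_reqs_cons body_reqs1.
  apply: achieves_cat (release9 hq D ck _ S) _; first by lia.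
  by move=> L' S'; apply: release10 S' => //; lia.
have -> : loop_reqs bits [::] (ph * n) n = [::].
  by rewrite /loop_reqs; elim: n (ph * n) => [//|m IH] x /=; rewrite IH.
(* Under insertions nothing is released: raising [p] only weakens the invariant, which below [p]
   constrains deletions alone. *)
split=> //=; case: S => h1 h2 h3 h4 h5 h6 h7; split=> //.
  by move=> q /h4; rewrite D /=; case: ifP => h; case: ifP => //; rewrite b'E; lia.
by move=> q /h5; rewrite D /=; case: ifP => h; case: ifP => //; rewrite b'E; lia.
Qed.

(** * Reading off the answer to an OMv3 query *)

Definition has_query (f : nat -> bool) (os : seq areq) : bool :=
  has (fun o => if o is AQry q then f (q %% n) else false) os.

Lemma has_query_loop f its b m :
  has_query f (loop_reqs bits its b m) =
  has (fun k => has_query f (body_reqs bits its (clock k))) (iota b m).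
Proof.
rewrite /has_query /loop_reqs; elim: (iota b m) => //= k ks IH.
by rewrite has_cat IH.
Qed.

Lemma has_query_guards f a b ty a' b' ty' q :
  has_query f (body_reqs bits [:: IGuard a b ty; IGuard a' b' ty'] q) = false.
Proof.
by rewrite body_reqs_cons body_reqs1 /=; case: ifP => _; case: ifP.
Qed.

(** The positions of one phase run through all remainders modulo [n], so a phase searches over all
    rows [i]. *)
Lemma has_query_phase f ph : ph < n ->
  has_query f (phase_reqs bits ph) = has f (iota 0 n).
Proof.
move=> hph; rewrite [LHS]has_cat has_cat -!/(has_query _ _) !has_query_loop.
have -> : has (fun k => has_query f (body_reqs bits pre_items (clock k)))
    (iota (ph * n) n) = false.
  by apply/hasP => -[k _]; rewrite has_query_guards.
have -> : has (fun k => has_query f (body_reqs bits post_items (clock k)))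
    (iota (ph * n) n) = false.
  by apply/hasP => -[k _]; rewrite /post_items; case: dec; rewrite ?has_query_guards.
rewrite orbF /=.
have mainE q : has_query f (body_reqs bits main_items q) = f (q %% n).
  by rewrite /main_items; case: dec; rewrite /has_query /= orbF.
under eq_has => k do rewrite mainE.
have [c hc pc] := phase_position hph.
apply/hasP/hasP => [[k _ hk]|[i]].
  by exists (clock k %% n) => //; rewrite mem_iota ltn_mod.
rewrite mem_iota => /= hi fi.
have hq : c * n + i < n * n by nia.
exists (clock (c * n + i)); last by rewrite clockK // modnMDl modn_small.
by rewrite mem_iota; have [-> _] := pc _ hq; rewrite divnMDl // divn_small // addn0.
Qed.

(** The vector [u] does not enter the graph; its bit masks the comparison with the threshold. *)
Definition hit (o : areq) (r : nat) : bool :=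
  if o is AQry q then bits 1 (q %% n) && (r <= threshold n q) else false.

Definition any_hit (os : seq areq) (rs : seq nat) : bool :=
  has (fun x => hit x.1 x.2) (zip os rs).

Lemma any_hitE L os rs : all (valid n) L -> uniq L ->
  admissible n dir (ready n A (bits 2) (bits 3)) L os ->
  correct_answers dir (inord 0) (inord 1) (map (oedge n) L)
    (map (creq n) os) rs ->
  any_hit os rs =
  has_query (fun i => bits 1 i && triangle n A (bits 2) (bits 3) i) os.
Proof.
elim: os L rs => [|[e|q] os IH] L [|r rs] //= vL uL.
  case=> ve te h; rewrite update_oedge // => h'.
  by rewrite /any_hit /= -/(any_hit _ _) (IH _ _ _ _ h h') // ?valid_toggle ?uniq_toggle.
case=> rq h [d h']; rewrite /any_hit /has_query /= -/(any_hit _ _) -/(has_query _ _).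
by rewrite (IH _ _ vL uL h h') (distance_triangle n_gt0 rq d).
Qed.

Lemma size_loop_reqs its b m : size (loop_reqs bits its b m) <= size its * m.
Proof.
elim: m b => [|m IH] b /=; first by rewrite muln0.
rewrite /loop_reqs /= size_cat -/(loop_reqs bits its b.+1 m) mulnS leq_add //.
elim: its {IH} => //= it its IH; rewrite /body_reqs /= size_cat.
by rewrite -add1n leq_add //; case: it => //= a b' ty; case: ifP.
Qed.

(** For each of the [n] positions, at most 2 requests before the main loop, 3 in it and 2 after
    it. *)
Lemma size_phase_reqs ph : size (phase_reqs bits ph) <= 7 * n.
Proof.
have h1 := size_loop_reqs pre_items (ph * n) n.
have h2 := size_loop_reqs main_items (ph * n) n.
have h3 := size_loop_reqs post_items (ph * n) n.
rewrite /phase_reqs !size_cat; move: h1 h2 h3.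
by rewrite /main_items /post_items; case: dec => /=; lia.
Qed.

(** * The initial graph *)

Definition init_types (a : bool) : seq nat :=
  [:: 0; 1; 2; 3] ++ (if a then [:: 4; 5; 6] else [::]) ++
  (if dec then [:: 7; 8; 9; 10] else [::]).

Definition init_at (q : nat) : seq code := [seq (ty, q) | ty <- init_types (A q)].

Definition init_codes (m : nat) : seq code := flatten [seq init_at q | q <- iota 0 m].

Lemma mem_init_codes m ty q :
  ((ty, q) \in init_codes m) = (q < m) && (ty \in init_types (A q)).
Proof.
apply/flatten_mapP/andP => [[q']|[hq hty]].
  by rewrite mem_iota => /= hq' /mapP[ty' h [-> ->]].
by exists q; [rewrite mem_iota | apply/mapP; exists ty].
Qed.

Lemma init_codesS m : init_codes m.+1 = init_codes m ++ init_at m.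
Proof.
by rewrite /init_codes -addn1 iotaD map_cat flatten_cat /= cats0.
Qed.

Lemma uniq_init_codes m : uniq (init_codes m).
Proof.
elim: m => // m IH; rewrite init_codesS cat_uniq IH andTb; apply/andP; split.
  by apply/hasPn => -[ty q] /mapP[ty' _ [_ ->]] /=; rewrite mem_init_codes ltnn.
rewrite map_inj_uniq; last by move=> x y [].
by rewrite /init_types; case: (A m); case: dec.
Qed.

Lemma sched_init : sched (init_codes (n * n)) 0 0 0 0 0 0.
Proof.
have types_lt a ty : ty \in init_types a -> ty < 11.
  rewrite /init_types !mem_cat !inE; case: a; case: dec; rewrite ?inE; lia.
have slot0 ty x : 7 <= ty < 11 -> slot (init_codes (n * n)) ty x 0 0.
  move=> hty q hq; rewrite !ltn0 /= /toggled mem_init_codes hq /=.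
  rewrite /init_types !mem_cat !inE; case: (A q); case: dec; rewrite ?inE; lia.
split; [|exact: uniq_init_codes| |exact: slot0|exact: slot0|exact: slot0|exact: slot0].
  apply/allP => -[ty q]; rewrite mem_init_codes /valid => /andP[-> /types_lt /= ->] //.
move=> ty q hty hq; rewrite mem_init_codes hq /=.
rewrite /init_types !mem_cat !inE; case: (A q); case: dec; rewrite ?inE; lia.
Qed.

End Schedule.

(** * Running one machine inside another *)

Section Machine.
Set Implicit Arguments.
Unset Strict Implicit.
Local Open Scope nat_scope.

(* The simulating program owns the registers below 32 and the arrays below 4;
   the simulated one lives in the remaining ones. *)
Definition join (rho : nat -> nat) (alpha : nat -> nat -> nat) (s : state) : state :=
  State (fun r => if r < 32 then rho r else reg s (r - 32))
        (fun a => if a < 4 then alpha a else arr s (a - 4)).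

Fixpoint shift (c : cmd) : cmd :=
  match c with
  | Skip => Skip
  | Const r k => Const (32 + r) k
  | Op o r r1 r2 => Op o (32 + r) (32 + r1) (32 + r2)
  | Read r a r1 => Read (32 + r) (4 + a) (32 + r1)
  | Write a r1 r2 => Write (4 + a) (32 + r1) (32 + r2)
  | Seq c1 c2 => Seq (shift c1) (shift c2)
  | If r c1 c2 => If (32 + r) (shift c1) (shift c2)
  | While r c => While (32 + r) (shift c)
  end.

Lemma reg_join_shift rho alpha s r : reg (join rho alpha s) (32 + r) = reg s r.
Proof.
rewrite -[LHS]/(if 32 + r < 32 then rho (32 + r) else reg s (32 + r - 32)).
by rewrite ltnNge leq_addr addKn.
Qed.

Lemma arr_join_shift rho alpha s a : arr (join rho alpha s) (4 + a) = arr s a.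
Proof.
rewrite -[LHS]/(if 4 + a < 4 then alpha (4 + a) else arr s (4 + a - 4)).
by rewrite ltnNge leq_addr addKn.
Qed.

Lemma set_reg_join_shift rho alpha s r x :
  set_reg (join rho alpha s) (32 + r) x = join rho alpha (set_reg s r x).
Proof.
rewrite /set_reg /join /=; congr State; apply: funext => r'; rewrite /upd.
case: ltnP => h; last by have -> : (r' - 32 == r) = (r' == 32 + r) by lia.
by have -> : (r' == 32 + r) = false by lia.
Qed.

Lemma set_arr_join_shift rho alpha s a f :
  set_arr (join rho alpha s) (4 + a) f = join rho alpha (set_arr s a f).
Proof.
rewrite /set_arr /join /=; congr State; apply: funext => r'; rewrite /upd.
case: ltnP => h; last by have -> : (r' - 4 == a) = (r' == 4 + a) by lia.
by have -> : (r' == 4 + a) = false by lia.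
Qed.

Lemma set_reg_join rho alpha s r x : r < 32 ->
  set_reg (join rho alpha s) r x = join (upd rho r x) alpha s.
Proof.
move=> hr; rewrite /set_reg /join /=; congr State; apply: funext => r'; rewrite /upd.
by case: eqP => [->|]; rewrite ?hr.
Qed.

Lemma reg_join rho alpha s r : r < 32 -> reg (join rho alpha s) r = rho r.
Proof. by rewrite /= => ->. Qed.

Lemma exec_shift w c s t s' : exec w c s t s' ->
  forall rho alpha, exec w (shift c) (join rho alpha s) t (join rho alpha s').
Proof.
elim=> {c s t s'} /=.
- by move=> s rho alpha; apply: exec_skip.
- by move=> r k s rho alpha; rewrite -set_reg_join_shift; apply: exec_const.
- move=> o r r1 r2 s rho alpha; rewrite -set_reg_join_shift.
  rewrite -(reg_join_shift rho alpha s r1) -(reg_join_shift rho alpha s r2).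
  exact: exec_op.
- move=> r a r1 s rho alpha; rewrite -set_reg_join_shift.
  rewrite -(reg_join_shift rho alpha s r1) -(arr_join_shift rho alpha s a).
  exact: exec_read.
- move=> a r1 r2 s rho alpha; rewrite -set_arr_join_shift.
  rewrite -(reg_join_shift rho alpha s r1) -(reg_join_shift rho alpha s r2).
  rewrite -(arr_join_shift rho alpha s a); exact: exec_write.
- by move=> c1 c2 s s1 s2 t1 t2 _ IH1 _ IH2 rho alpha; apply: exec_seq.
- move=> r c1 c2 s s' t _ IH rho alpha; apply: exec_if.
  by rewrite reg_join_shift; have := IH rho alpha; case: ifP.
- by move=> r c s h rho alpha; apply: exec_while_stop; rewrite reg_join_shift.
- move=> r c s s1 s2 t1 t2 h _ IH1 _ IH2 rho alpha.
  by apply: exec_while_step; [rewrite reg_join_shift|apply: IH1|apply: IH2].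
Qed.

Lemma exec_gt0 w c s t s' : exec w c s t s' -> 0 < t.
Proof. by elim=> // *; rewrite addn_gt0; apply/orP; left. Qed.

Definition block (cs : seq cmd) : cmd := foldr Seq Skip cs.

Definition own (c : cmd) : bool :=
  match c with
  | Const r _ => r < 32
  | Op _ r r1 r2 => [&& r < 32, r1 < 32 & r2 < 32]
  | Read r a r1 => [&& r < 32, a < 4 & r1 < 32]
  | _ => false
  end.

(** Straight-line code of the simulating program acts on its registers only: [own] admits no writes,
    so [alpha] and the simulated state stay fixed. *)
Definition step (w : nat) (alpha : nat -> nat -> nat) (rho : nat -> nat) (c : cmd)
    : nat -> nat :=
  match c with
  | Const r k => upd rho r (k %% 2 ^ w)
  | Op o r r1 r2 => upd rho r (eval_binop w o (rho r1) (rho r2))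
  | Read r a r1 => upd rho r (alpha a (rho r1))
  | _ => rho
  end.

Lemma exec_own w alpha rho s c : own c ->
  exec w c (join rho alpha s) 1 (join (step w alpha rho c) alpha s).
Proof.
case: c => //=.
- by move=> r k hr; rewrite -set_reg_join //; apply: exec_const.
- move=> o r r1 r2 /and3P[hr h1 h2]; rewrite -set_reg_join //.
  by rewrite -(reg_join rho alpha s h1) -(reg_join rho alpha s h2); apply: exec_op.
- move=> r a r1 /and3P[hr ha h1]; rewrite -set_reg_join // -(reg_join rho alpha s h1).
  have -> : alpha a = arr (join rho alpha s) a by rewrite /= ha.
  exact: exec_read.
Qed.

Lemma exec_block w alpha rho s cs : all own cs ->
  exec w (block cs) (join rho alpha s) (size cs).+1
    (join (foldl (step w alpha) rho cs) alpha s).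
Proof.
elim: cs rho => [|c cs IH] rho /=; first by move=> _; apply: exec_skip.
case/andP=> /exec_own h /IH h'; rewrite -add1n.
exact: exec_seq (h _ _ _ _) (h' _).
Qed.

(** * Word operations without overflow *)

Section Words.
Variable w : nat.

Lemma eval_add x y : x + y < 2 ^ w -> eval_binop w WAdd x y = x + y.
Proof. by move=> h; rewrite /eval_binop modn_small. Qed.

Lemma eval_mul x y : x * y < 2 ^ w -> eval_binop w WMul x y = x * y.
Proof. by move=> h; rewrite /eval_binop modn_small. Qed.

Lemma eval_sub x y : y <= x < 2 ^ w -> eval_binop w WSub x y = x - y.
Proof.
case/andP=> h1 h2; rewrite /eval_binop -addnBAC // modnDr modn_small //.
exact: leq_ltn_trans (leq_subr _ _) h2.
Qed.

Lemma eval_div x y : x < 2 ^ w -> eval_binop w WDiv x y = x %/ y.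
Proof.
by move=> h; rewrite /eval_binop modn_small // (leq_ltn_trans (leq_div _ _) h).
Qed.

Lemma eval_mod x y : x < 2 ^ w -> eval_binop w WMod x y = x %% y.
Proof.
by move=> h; rewrite /eval_binop modn_small // (leq_ltn_trans (leq_mod _ _) h).
Qed.

Lemma eval_lt x y : 1 < 2 ^ w -> eval_binop w WLt x y = (x < y).
Proof. by move=> h; rewrite /eval_binop modn_small //; case: (x < y); lia. Qed.

Lemma eval_or (x y : bool) : 1 < 2 ^ w -> eval_binop w WOr x y = (x || y).
Proof.
move=> h; have h0 : 0 < 2 ^ w := ltnW h.
by case: x; case: y; rewrite /eval_binop modn_small.
Qed.

End Words.

(** * Splitting a run into consecutive batches of requests *)

Section Requests.
Variables (w : nat) (O : Type) (handler : O -> cmd) (put : O -> state -> state).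

(* [serve] with the final state made explicit. *)
Inductive run : state -> seq O -> seq nat -> nat -> state -> Prop :=
| run_nil s : run s [::] [::] 0 s
| run_cons o os rs s s' s'' t T :
    exec w (handler o) (put o s) t s' -> run s' os rs T s'' ->
    run s (o :: os) (reg s' 0 :: rs) (t + T) s''.

Lemma run_size s os rs T s' : run s os rs T s' -> size rs = size os.
Proof. by elim=> //= *; congr S. Qed.

Lemma serve_cat s os1 os2 rs T : serve w handler put s (os1 ++ os2) rs T ->
  exists rs1 rs2 T1 T2 s', [/\ run s os1 rs1 T1 s',
    serve w handler put s' os2 rs2 T2, rs = rs1 ++ rs2 & T = T1 + T2].
Proof.
elim: os1 s rs T => [|o os1 IH] s rs T /=.
  by move=> h; exists [::], rs, 0, T, s; split=> //; apply: run_nil.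
move E: (o :: os1 ++ os2) => os h; case: h E => // {s rs T os}.
move=> o' os rs s s' t T h1 h2 [Eo Eos]; subst o' os.
have [rs1 [rs2 [T1 [T2 [s1 [h3 h4 -> ->]]]]]] := IH _ _ _ h2.
exists (reg s' 0 :: rs1), rs2, (t + T1), T2, s1; split=> //; last by rewrite addnA.
exact: run_cons h1 h3.
Qed.

Lemma run_cat_inv s os1 os2 rs T s2 : run s (os1 ++ os2) rs T s2 ->
  exists rs1 rs2 T1 T2 s', [/\ run s os1 rs1 T1 s',
    run s' os2 rs2 T2 s2, rs = rs1 ++ rs2 & T = T1 + T2].
Proof.
elim: os1 s rs T => [|o os1 IH] s rs T /=.
  by move=> h; exists [::], rs, 0, T, s; split=> //; apply: run_nil.
move E: (o :: os1 ++ os2) => os h; case: h E IH => // {s rs T os s2}.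
move=> o' os rs s s' s2 t T h1 h2 [Eo Eos] IH; subst o' os.
have [rs1 [rs2 [T1 [T2 [s1 [h3 h4 -> ->]]]]]] := IH _ _ _ h2.
exists (reg s' 0 :: rs1), rs2, (t + T1), T2, s1; split=> //; last by rewrite addnA.
exact: run_cons h1 h3.
Qed.

Lemma run_nil_inv s rs T s' : run s [::] rs T s' -> [/\ rs = [::], T = 0 & s' = s].
Proof. by move E: [::] => os h; case: h E. Qed.

Lemma run1_inv s o rs T s' : run s [:: o] rs T s' ->
  exec w (handler o) (put o s) T s' /\ rs = [:: reg s' 0].
Proof.
move E: [:: o] => os h; case: h E => // {s rs T s' os}.
move=> o' os rs s s' s'' t T h1 h2 [Eo Eos]; subst o' os.
by case: (run_nil_inv h2) => -> -> ->; rewrite addn0.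
Qed.

End Requests.
End Machine.

(** * Answering an OMv3 query *)

(* Registers of the simulating program: 0 answer; 1 n; 2 phase; 3, 4, 5 loop
   counter, bound and test; 6 to 10 the values [position n x q] for x < 5;
   11 the constant 1; 12 the constant 8; 13 n^2; 14 to 17 scratch;
   19 number of edges; 20 the power of two below n; 31 the constant 0. *)
Section Simulation.
Set Implicit Arguments.
Unset Strict Implicit.
Local Open Scope nat_scope.

Definition setup_cmds (d : bool) : seq cmd :=
  (if d then [:: Op WAdd 8 3 31] else [:: Op WSub 8 13 3; Op WSub 8 8 11]) ++
  [:: Op WMod 6 8 1; Op WDiv 7 8 1; Op WAdd 9 8 11; Op WAdd 10 8 1].

Definition load_cmds (ty : nat) : seq cmd :=
  let e := edge_shape ty in
  [:: Const 14 e.1.1; Op WMul 15 12 (6 + e.1.2); Op WAdd 14 14 15;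
      Const 16 e.2.1; Op WMul 17 12 (6 + e.2.2); Op WAdd 16 16 17].

Variables (n : nat).
Record env (rho : nat -> nat) : Prop := Env {
  env1 : rho 1 = n; env11 : rho 11 = 1; env12 : rho 12 = 8;
  env13 : rho 13 = n * n; env31 : rho 31 = 0 }.

Definition at_pos (rho : nat -> nat) (q : nat) : Prop :=
  forall x, x < 5 -> rho (6 + x) = position n x q.

(** Register 0 is exempt because it accumulates the answer; its value is tracked separately. *)
Definition frame (lo hi : nat) (rho rho' : nat -> nat) : Prop :=
  forall r, 0 < r -> ~~ (lo <= r <= hi) -> rho' r = rho r.

Lemma env_frame lo hi rho rho' : (13 < lo) || (hi < 11) && (1 < lo) -> hi < 31 ->
  frame lo hi rho rho' -> env rho -> env rho'.
Proof. by move=> h h' f [? ? ? ? ?]; split; rewrite f //; lia. Qed.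

Lemma frame_trans lo hi rho1 rho2 rho3 :
  frame lo hi rho1 rho2 -> frame lo hi rho2 rho3 -> frame lo hi rho1 rho3.
Proof. by move=> f g r h0 h; rewrite g ?f. Qed.

Lemma at_pos_frame lo hi rho rho' q :
  frame lo hi rho rho' -> 10 < lo -> at_pos rho q -> at_pos rho' q.
Proof. by move=> f hlo h x hx; rewrite f ?h //; lia. Qed.

Hypothesis n_gt0 : 0 < n.
Variable w : nat.
Hypothesis hw : 16 * (n * n) < 2 ^ w.
Variable alpha : nat -> nat -> nat.

Lemma exec_setup dir rho s k : env rho -> rho 3 = k -> k < n * n ->
  exists t rho', [/\ exec w (block (setup_cmds (dec dir))) (join rho alpha s) t
      (join rho' alpha s), t <= 7, at_pos rho' (clock n dir k),
      frame 6 10 rho rho' & rho' 0 = rho 0].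
Proof.
case=> e1 e11 e12 e13 e31 e3 hk.
have hq := clock_lt dir hk; set q := clock n dir k in hq *.
have h1 : n <= n * n by rewrite leq_pmulr.
have ow : all own (setup_cmds (dec dir)) by case: dec.
do 2!eexists; split; first exact: exec_block ow.
- by case: dec.
- rewrite foldl_cat; set rho1 := foldl _ rho _.
  have E8 : rho1 8 = q.
    rewrite /q /clock /rho1; case: dec; rewrite /= /upd /=.
      by rewrite e3 e31 eval_add; lia.
    rewrite e3 e13 e11 (@eval_sub _ (n * n)); last by lia.
    by rewrite eval_sub //; lia.
  have E1 : rho1 1 = n by rewrite /rho1; case: dec.
  have E11 : rho1 11 = 1 by rewrite /rho1; case: dec.
  move=> x hx; case: x hx => [|[|[|[|[|x]]]]] // _; rewrite /position /= /upd /=.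
  + by rewrite E8 E1 eval_mod //; lia.
  + by rewrite E8 E1 eval_div //; lia.
  + by rewrite E8 E11 eval_add; lia.
  + by rewrite E8 E1 eval_add; lia.
- move=> r _ hr; have ne x : 6 <= x <= 10 -> (r == x) = false.
    by move=> hx; apply: contraNF hr => /eqP ->.
  by case: dec; rewrite /= /upd !ne.
- by case: dec.
Qed.

Lemma exec_load rho s ty q : env rho -> at_pos rho q -> valid n (ty, q) ->
  exists t rho', [/\ exec w (block (load_cmds ty)) (join rho alpha s) t
      (join rho' alpha s), t <= 7, rho' 14 = src n (ty, q) /\ rho' 16 = tgt n (ty, q),
      frame 14 17 rho rho' & rho' 0 = rho 0].
Proof.
case=> e1 e11 e12 e13 e31 hp hv.
have /andP[/= hty hq] := hv.
have hs : src n (ty, q) < 2 ^ w.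
  by apply: leq_trans (ltnW hw); rewrite -graph_orderE // src_lt.
have ht : tgt n (ty, q) < 2 ^ w.
  by apply: leq_trans (ltnW hw); rewrite -graph_orderE // tgt_lt.
have x5 : ((edge_shape ty).1.2 < 5) && ((edge_shape ty).2.2 < 5).
  have /allP : all (fun ty => ((edge_shape ty).1.2 < 5) &&
    ((edge_shape ty).2.2 < 5)) (iota 0 11) by [].
  by apply; rewrite mem_iota.
case/andP: x5 => x1 x2.
move: hs ht; rewrite /src /tgt /vertex /load_cmds /=.
move: (edge_shape ty) x1 x2 => [[k1 y1] [k2 y2]] /= x1 x2 hs ht.
have p1 := hp _ x1; have p2 := hp _ x2.
have ow : all own [:: Const 14 k1; Op WMul 15 12 (6 + y1); Op WAdd 14 14 15;
      Const 16 k2; Op WMul 17 12 (6 + y2); Op WAdd 16 16 17].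
  by rewrite /= !andbT; lia.
do 2!eexists; split; first exact: exec_block ow.
- by [].
- split.
  have ne x : 13 < x -> (6 + y1 == x) = false by lia.
  rewrite [foldl _ _ _]/= /upd [LHS]/= -/(6 + y1) ne // p1 e12 !modn_small; last by lia.
  by rewrite eval_mul ?eval_add; lia.
  have ne x : 13 < x -> (6 + y2 == x) = false by lia.
  rewrite [foldl _ _ _]/= /upd [LHS]/= -/(6 + y2) !ne // p2 e12 !modn_small; last by lia.
  by rewrite eval_mul ?eval_add; lia.
- move=> r _ hr; have ne x : 14 <= x <= 17 -> (r == x) = false.
    by move=> hx; apply: contraNF hr => /eqP ->.
  by rewrite /= /upd !ne.
- by [].
Qed.

Variables (dir : direction) (P : stsp_alg) (bits : nat -> nat -> bool).
Hypothesis alphaE : forall a, 0 < a < 4 -> forall i, alpha a i = bits a i.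

Local Notation run := (run w (@stsp_handler P (graph_order n))
  (@stsp_put (graph_order n))).

(** Registers 32 and 33 are registers 0 and 1 of the simulated machine, where [stsp_put] leaves the
    endpoints. Adding register 31, which is 0, serves as a move. *)
Definition update_cmd (ty : nat) : cmd :=
  Seq (block (load_cmds ty))
    (Seq (Op WAdd 32 14 31) (Seq (Op WAdd 33 16 31) (shift (stsp_upd P)))).

(** Register 14 becomes [2 (q + c) + 8], one more than the threshold, so that the strict comparison
    tests [<=]. The product with the bit of [u] is a conjunction; register 0 collects the
    disjunction. *)
Definition test_cmd : cmd :=
  Seq (shift (stsp_qry P))
    (Seq (block [:: Op WAdd 14 8 7; Op WAdd 14 14 14; Op WAdd 14 14 12])
      (Seq (Op WLt 15 32 14)
        (block [:: Read 16 1 6; Op WMul 15 15 16; Op WOr 0 0 15]))).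

Definition item_cmd (it : item) : cmd :=
  match it with
  | IUpd ty => update_cmd ty
  | IGuard a b ty =>
      Seq (Read 14 a 6)
        (If 14 (if b then update_cmd ty else Skip) (if b then Skip else update_cmd ty))
  | ITest => test_cmd
  end.

Definition item_ok (it : item) : bool :=
  match it with
  | IUpd ty => ty < 11
  | IGuard a _ ty => (0 < a < 4) && (ty < 11)
  | ITest => true
  end.

Lemma exec_move rho s r0 r : env rho -> r < 32 -> rho r < 2 ^ w ->
  exec w (Op WAdd (32 + r0) r 31) (join rho alpha s) 1
    (join rho alpha (set_reg s r0 (rho r))).
Proof.
move=> e hr h; have := exec_op w WAdd (32 + r0) r 31 (join rho alpha s).
by rewrite set_reg_join_shift !reg_join // (env31 e) eval_add addn0.
Qed.

Lemma exec_update rho s ty q rs T s' : env rho -> at_pos rho q -> valid n (ty, q) ->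
  run s [:: creq n (AUpd (ty, q))] rs T s' ->
  exists t rho', [/\ exec w (update_cmd ty) (join rho alpha s) t (join rho' alpha s'),
    t <= 9 + T, frame 14 17 rho rho' & rho' 0 = rho 0].
Proof.
move=> e hp hv hr; have [h _] := run1_inv hr; rewrite /= in h.
have [t [rho' [h1 ht [h14 h16] hf h0]]] := exec_load s e hp hv.
have e' : env rho' by apply: env_frame hf e.
have hs : src n (ty, q) < graph_order n by apply: src_lt.
have htg : tgt n (ty, q) < graph_order n by apply: tgt_lt.
have gw : graph_order n < 2 ^ w by rewrite graph_orderE.
exists (t + (1 + (1 + T))), rho'; split=> //; last by lia.
apply: exec_seq h1 _; apply: exec_seq (exec_move _ _ e' _ _) _ => //.
  by rewrite h14 (ltn_trans hs).
apply: exec_seq (@exec_move _ _ 1 _ e' _ _) _ => //.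
  by rewrite h16 (ltn_trans htg).
by apply: exec_shift; rewrite h14 h16; move: h; rewrite !inordK.
Qed.

Lemma exec_test rho s q rs T s' (x : bool) : env rho -> at_pos rho q -> q < n * n ->
  rho 0 = x -> run s [:: creq n (AQry q)] rs T s' ->
  exists t rho', [/\ exec w test_cmd (join rho alpha s) t (join rho' alpha s'),
    t <= 9 + T, frame 14 17 rho rho' & rho' 0 = x || any_hit n bits [:: AQry q] rs].
Proof.
move=> e hp hq h0 hr; have [h ->] := run1_inv hr; rewrite /= in h.
have [e1 e11 e12 e13 e31] := e.
have w1 : 1 < 2 ^ w by apply: leq_ltn_trans hw; rewrite !muln_gt0 n_gt0.
have hn : n <= n * n by rewrite leq_pmulr.
have hd : q %/ n <= q by apply: leq_div.
have E8 : rho 8 = q by rewrite (hp 2).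
have E7 : rho 7 = q %/ n by rewrite (hp 1).
have E6 : rho 6 = q %% n by rewrite (hp 0).
pose c1 := [:: Op WAdd 14 8 7; Op WAdd 14 14 14; Op WAdd 14 14 12].
pose c2 := [:: Read 16 1 6; Op WMul 15 15 16; Op WOr 0 0 15].
pose rho1 := foldl (step w alpha) rho c1.
have E14 : rho1 14 = (threshold n q).+1.
  rewrite /rho1 /= /upd /= E8 E7 e12 (@eval_add _ q); last by lia.
  by rewrite !eval_add /threshold; lia.
pose hitb := reg s' 0 < rho1 14.
pose rho2 := upd rho1 15 hitb.
exists (T + (4 + (1 + 4))), (foldl (step w alpha) rho2 c2); split.
- apply: exec_seq (exec_shift h _ _) _.
  apply: exec_seq (@exec_block w alpha rho s' c1 isT) _.
  apply: exec_seq _ (@exec_block w alpha rho2 s' c2 isT).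
  have := exec_op w WLt 15 32 14 (join rho1 alpha s').
  by rewrite set_reg_join // (reg_join_shift _ _ _ 0) reg_join // eval_lt.
- by lia.
- move=> r hr0 hlr.
  have ne y : (y == 0) || (14 <= y <= 17) -> (r == y) = false by lia.
  by rewrite /rho2 /rho1 /c1 /c2 /= /upd !ne.
- rewrite /rho2 /c2 /= /upd /= -[rho1 0]/(rho 0) -[rho1 6]/(rho 6) h0 E6 alphaE //.
  rewrite /any_hit /= orbF /hitb E14 ltnS [in RHS]andbC.
  rewrite eval_mul; last by apply: leq_ltn_trans w1; rewrite mulnb leq_b1.
  by rewrite mulnb eval_or.
Qed.

Lemma exec_item rho s it q rs T s' (x : bool) : env rho -> at_pos rho q -> q < n * n ->
  item_ok it -> rho 0 = x -> run s (map (creq n) (item_reqs n bits it q)) rs T s' ->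
  exists t rho', [/\ exec w (item_cmd it) (join rho alpha s) t (join rho' alpha s'),
    t <= 11 + T, frame 14 17 rho rho'
    & rho' 0 = x || any_hit n bits (item_reqs n bits it q) rs].
Proof.
move=> e hp hq ok h0.
have upd_case ty rho1 : ty < 11 -> env rho1 ->
    at_pos rho1 q -> rho1 0 = x ->
    run s (map (creq n) [:: AUpd (ty, q)]) rs T s' ->
    exists t rho', [/\ exec w (update_cmd ty) (join rho1 alpha s) t (join rho' alpha s'),
      t <= 9 + T, frame 14 17 rho1 rho'
      & rho' 0 = x || any_hit n bits [:: AUpd (ty, q)] rs].
  move=> hty e1 hp1 h1 hr.
  have hv : valid n (ty, q) by rewrite /valid hty.
  have [t [rho' [h2 h3 h4 h5]]] := exec_update e1 hp1 hv hr.
  exists t, rho'; split=> //; rewrite h5 h1.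
  by have [_ ->] := run1_inv hr; rewrite /any_hit /= orbF.
case: it ok => [ty|a b ty|] /= ok hr.
- have [t [rho' [h1 h2 h3 h4]]] := upd_case ty rho ok e hp h0 hr.
  by exists t, rho'; split=> //; lia.
- case/andP: ok => ha hty; pose rho1 := upd rho 14 (alpha a (rho 6)).
  have f1 : frame 14 17 rho rho1.
    by move=> r _ hlr; rewrite /rho1 /upd; case: eqP => // E; rewrite E in hlr.
  have e1 : env rho1 by apply: env_frame f1 e.
  have hp1 := at_pos_frame f1 isT hp.
  have hread : exec w (Read 14 a 6) (join rho alpha s) 1 (join rho1 alpha s).
    by apply: (@exec_own w alpha rho s (Read 14 a 6)); rewrite /=; lia.
  have E14 : reg (join rho1 alpha s) 14 = bits a (q %% n).
    by rewrite reg_join // /rho1 /upd eqxx (hp 0) // alphaE.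
  move: hr; case: ifP => hb hr.
    have [t [rho' [h1 h2 h3 h4]]] := upd_case ty rho1 hty e1 hp1 h0 hr.
    exists (1 + t.+1), rho'; split=> //; [|exact: frame_trans f1 h3].
    apply: exec_seq hread _; apply: exec_if.
    by rewrite E14 (eqP hb); case: (b) h1.
  have [-> -> ->] := run_nil_inv hr.
  exists 3, rho1; split=> //; last by rewrite orbF.
  apply: (@exec_seq _ _ _ _ _ _ 1 2) hread _; apply: exec_if.
  rewrite E14; have -> : bits a (q %% n) = ~~ b by move: hb; case: bits; case: (b).
  by case: (b); apply: exec_skip.
- have [t [rho' [h1 h2 h3 h4]]] := exec_test e hp hq h0 hr.
  by exists t, rho'; split=> //; lia.
Qed.

Lemma any_hit_cat os1 os2 rs1 rs2 : size rs1 = size os1 ->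
  any_hit n bits (os1 ++ os2) (rs1 ++ rs2) =
  any_hit n bits os1 rs1 || any_hit n bits os2 rs2.
Proof. by move=> h; rewrite /any_hit zip_cat // has_cat. Qed.

Lemma exec_body rho s its q rs T s' (x : bool) : env rho -> at_pos rho q ->
  q < n * n -> all item_ok its -> rho 0 = x ->
  run s (map (creq n) (body_reqs n bits its q)) rs T s' ->
  exists t rho', [/\ exec w (block (map item_cmd its)) (join rho alpha s) t
      (join rho' alpha s'),
    t <= 1 + 11 * size its + T, frame 14 17 rho rho'
    & rho' 0 = x || any_hit n bits (body_reqs n bits its q) rs].
Proof.
elim: its rho s rs T x => [|it its IH] rho s rs T x e hp hq /=.
  move=> _ h0 hr; have [-> -> ->] := run_nil_inv hr.
  by exists 1, rho; split=> //; [apply: exec_skip|rewrite orbF].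
case/andP=> ok oks h0; rewrite body_reqs_cons map_cat => hr.
have [rs1 [rs2 [T1 [T2 [s1 [r1 r2 -> ->]]]]]] := run_cat_inv hr.
have [t1 [rho1 [x1 l1 f1 o1]]] := exec_item e hp hq ok h0 r1.
have e1 : env rho1 by apply: env_frame f1 e.
have [t2 [rho2 [x2 l2 f2 o2]]] := IH _ _ _ _ _ e1 (at_pos_frame f1 isT hp) hq oks o1 r2.
exists (t1 + t2), rho2; split; [exact: exec_seq x1 x2|by lia|exact: frame_trans f1 f2|].
by rewrite o2 any_hit_cat ?orbA // (run_size r1) size_map.
Qed.

Definition loop_body (its : seq item) : cmd :=
  Seq (block (setup_cmds (dec dir)))
    (Seq (block (map item_cmd its)) (block [:: Op WAdd 3 3 11; Op WLt 5 3 4])).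

Definition loop_cmd (its : seq item) : cmd :=
  Seq (block [:: Op WMul 3 2 1; Op WAdd 4 3 1; Op WLt 5 3 4]) (While 5 (loop_body its)).

Lemma exec_while its rho s k m rs T s' (x : bool) : env rho -> k + m <= n * n ->
  rho 3 = k -> rho 4 = k + m -> rho 5 = (0 < m) ->
  all item_ok its -> size its <= 3 -> rho 0 = x ->
  run s (map (creq n) (loop_reqs n dir bits its k m)) rs T s' ->
  exists t rho', [/\ exec w (While 5 (loop_body its)) (join rho alpha s) t
      (join rho' alpha s'),
    t <= 1 + 45 * m + T, env rho', rho' 2 = rho 2
    & rho' 0 = x || any_hit n bits (loop_reqs n dir bits its k m) rs].
Proof.
move=> + + + + + oks sz.
elim: m rho s k rs T x => [|m IH] rho s k rs T x e hk h3 h4 h5 h0 /= hr.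
  have [-> -> ->] := run_nil_inv hr.
  exists 1, rho; split=> //; last by rewrite orbF.
  by apply: exec_while_stop; rewrite reg_join.
move: hr; rewrite /loop_reqs /= map_cat => hr.
have [rs1 [rs2 [T1 [T2 [s1 [r1 r2 -> ->]]]]]] := run_cat_inv hr.
have kn : k < n * n by lia.
have [t1 [rho1 [x1 l1 p1 f1 o1]]] := exec_setup dir s e h3 kn.
have e1 : env rho1 by apply: env_frame f1 e.
have [t2 [rho2 [x2 l2 f2 o2]]] :=
  exec_body e1 p1 (clock_lt dir kn) oks (etrans o1 h0) r1.
have e2 : env rho2 by apply: env_frame f2 e1.
have w1 : 1 < 2 ^ w by apply: leq_ltn_trans hw; rewrite !muln_gt0 n_gt0.
pose rho3 := foldl (step w alpha) rho2 [:: Op WAdd 3 3 11; Op WLt 5 3 4].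
have E r : 0 < r < 6 -> rho2 r = rho r.
  by move=> hr'; rewrite f2 ?f1 //; lia.
have f3 : frame 3 5 rho2 rho3.
  move=> r _ hlr; have ne y : 3 <= y <= 5 -> (r == y) = false.
    by move=> hy; apply: contraNF hlr => /eqP ->.
  by rewrite /rho3 /= /upd !ne.
have e3 : env rho3 by apply: env_frame f3 e2.
have E3 : rho3 3 = k.+1.
  have -> : rho3 3 = eval_binop w WAdd (rho2 3) (rho2 11) by [].
  by rewrite (E 3) // h3 (env11 e2) eval_add addn1 //; lia.
have E4 : rho3 4 = k.+1 + m by rewrite -[LHS]/(rho2 4) E // h4; lia.
have E5 : rho3 5 = (0 < m).
  have -> : rho3 5 = eval_binop w WLt (rho3 3) (rho3 4) by [].
  by rewrite E3 E4 eval_lt // -[X in X < _]addn0 ltn_add2l.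
have hk' : k.+1 + m <= n * n by lia.
have [t4 [rho4 [x4 l4 e4 E42 o4]]] := IH _ _ _ _ _ _ e3 hk' E3 E4 E5 o2 r2.
(* Apart from the requests, a round costs at most 7 + 34 + 3 + 1 = 45 steps: setup, items, counter
   and loop test. *)
exists (t1 + (t2 + 3) + t4).+1, rho4; split=> //.
- apply: exec_while_step x4; first by rewrite reg_join // h5.
  apply: exec_seq x1 _; apply: exec_seq x2 _.
  exact: (@exec_block w alpha rho2 s1 [:: Op WAdd 3 3 11; Op WLt 5 3 4]).
- by lia.
- by rewrite E42 f3 // E.
- by rewrite o4 any_hit_cat ?orbA // (run_size r1) size_map.
Qed.

Lemma exec_loop its rho s ph rs T s' (x : bool) : env rho -> ph < n ->
  rho 2 = ph -> all item_ok its -> size its <= 3 -> rho 0 = x ->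
  run s (map (creq n) (loop_reqs n dir bits its (ph * n) n)) rs T s' ->
  exists t rho', [/\ exec w (loop_cmd its) (join rho alpha s) t (join rho' alpha s'),
    t <= 5 + 45 * n + T, env rho', rho' 2 = ph
    & rho' 0 = x || any_hit n bits (loop_reqs n dir bits its (ph * n) n) rs].
Proof.
move=> e hph h2 oks sz h0 hr.
have hb : ph * n + n <= n * n by rewrite -mulSnr leq_mul2r hph orbT.
have w1 : 1 < 2 ^ w by apply: leq_ltn_trans hw; rewrite !muln_gt0 n_gt0.
pose cs := [:: Op WMul 3 2 1; Op WAdd 4 3 1; Op WLt 5 3 4].
pose rho1 := foldl (step w alpha) rho cs.
have f1 : frame 3 5 rho rho1.
  move=> r _ hlr; have ne y : 3 <= y <= 5 -> (r == y) = false.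
    by move=> hy; apply: contraNF hlr => /eqP ->.
  by rewrite /rho1 /= /upd !ne.
have e1 : env rho1 by apply: env_frame f1 e.
have E3 : rho1 3 = ph * n.
  by rewrite /rho1 /= /upd /= h2 (env1 e) eval_mul //; lia.
have E4 : rho1 4 = ph * n + n.
  have -> : rho1 4 = eval_binop w WAdd (rho1 3) (rho1 1) by [].
  by rewrite E3 (env1 e1) eval_add //; lia.
have E5 : rho1 5 = (0 < n).
  have -> : rho1 5 = eval_binop w WLt (rho1 3) (rho1 4) by [].
  by rewrite E3 E4 eval_lt // -[X in X < _]addn0 ltn_add2l.
have [t [rho' [h1 h3 h4 h5 h6]]] := exec_while e1 hb E3 E4 E5 oks sz h0 hr.
exists (4 + t), rho'; split=> //; last by rewrite h5 f1.
exact: exec_seq (@exec_block w alpha rho s cs isT) h1.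
Qed.

Definition phase_cmd : cmd :=
  Seq (Const 0 0) (Seq (loop_cmd (pre_items dir)) (Seq (loop_cmd (main_items dir))
    (Seq (loop_cmd (post_items dir)) (Op WAdd 2 2 11)))).

Lemma exec_phase rho s ph rs T s' : env rho -> ph < n -> rho 2 = ph ->
  run s (map (creq n) (phase_reqs n dir bits ph)) rs T s' ->
  exists t rho', [/\ exec w phase_cmd (join rho alpha s) t (join rho' alpha s'),
    t <= 152 * n + T, env rho', rho' 2 = ph.+1
    & rho' 0 = any_hit n bits (phase_reqs n dir bits ph) rs].
Proof.
move=> e hph h2; rewrite /phase_reqs !map_cat => hr.
have [rs1 [rs23 [T1 [T23 [s1 [r1 r23 -> ->]]]]]] := run_cat_inv hr.
have [rs2 [rs3 [T2 [T3 [s2 [r2 r3 -> ->]]]]]] := run_cat_inv r23.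
have hn : n <= n * n by rewrite leq_pmulr.
pose rho0 := upd rho 0 0.
have e0 : env rho0 by case: e.
have x0 : exec w (Const 0 0) (join rho alpha s) 1 (join rho0 alpha s).
  by have := @exec_own w alpha rho s (Const 0 0) isT; rewrite /= mod0n.
have [] := @exec_loop (pre_items dir) rho0 s ph rs1 T1 s1 false e0 hph h2 _ _ erefl r1.
- by [].
- by [].
move=> t1 [rho1 [x1 l1 e1 E1 o1]].
have [] := @exec_loop (main_items dir) rho1 s1 ph rs2 T2 s2 _ e1 hph E1 _ _ o1 r2.
- by rewrite /main_items; case: dec.
- by rewrite /main_items; case: dec.
move=> t2 [rho2 [x2 l2 e2 E2 o2]].
have [] := @exec_loop (post_items dir) rho2 s2 ph rs3 T3 s' _ e2 hph E2 _ _ o2 r3.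
- by rewrite /post_items; case: dec.
- by rewrite /post_items; case: dec.
move=> t3 [rho3 [x3 l3 e3 E3 o3]].
pose rho4 := upd rho3 2 (eval_binop w WAdd (rho3 2) (rho3 11)).
(* Three loops of [5 + 45 n] steps and two more instructions: [135 n + 17 <= 152 n] as [n] is
   positive. *)
exists (1 + (t1 + (t2 + (t3 + 1)))), rho4; split.
- apply: exec_seq x0 _; apply: exec_seq x1 _; apply: exec_seq x2 _.
  apply: exec_seq x3 _; exact: (@exec_own w alpha rho3 s' (Op WAdd 2 2 11)).
- by lia.
- by case: e3.
- by rewrite /rho4 /upd eqxx E3 (env11 e3) eval_add addn1 //; lia.
- rewrite /rho4 /upd /= o3 /= !any_hit_cat ?orbA //.
    by rewrite (run_size r2) size_map.
  by rewrite (run_size r1) size_map.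
Qed.

End Simulation.

(** * Building the initial graph *)

Section Preprocessing.
Set Implicit Arguments.
Unset Strict Implicit.
Local Open Scope nat_scope.

(** Arrays 4 and 5 are the edge arrays of the simulated machine; the edge count in register 19 is
    the next free index. *)
Definition emit_cmd (ty : nat) : cmd :=
  Seq (block (load_cmds ty))
    (Seq (Write 4 19 14) (Seq (Write 5 19 16) (Op WAdd 19 19 11))).

Definition emits (tys : seq nat) : cmd := block (map emit_cmd tys).

(** For either [dir], the setup takes the loop counter itself as position, so edges appear in the
    order of [init_codes]. *)
Definition build_body (dir : direction) : cmd :=
  Seq (block (setup_cmds true))
    (Seq (emits [:: 0; 1; 2; 3])
      (Seq (Read 14 0 8)
        (Seq (If 14 (emits [:: 4; 5; 6]) Skip)
          (Seq (emits (if dec dir then [:: 7; 8; 9; 10] else [::]))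
            (block [:: Op WAdd 3 3 11; Op WLt 5 3 13]))))).

Definition power_body : cmd :=
  block [:: Op WAdd 20 20 20; Op WAdd 14 20 20; Op WLt 5 14 15].

Variables (n : nat).
Hypothesis n_gt0 : 0 < n.

Definition edge_bound : nat := 64 * (2 ^ trunc_log 2 n * 2 ^ trunc_log 2 n).

(** For [p = 2 ^ trunc_log 2 n] one has [p <= n < 2 p], hence [n^2 <= 4 p^2 <= 4 n^2]. *)
Lemma edge_boundP : 16 * (n * n) <= edge_bound <= 64 * (n * n).
Proof.
have /andP[h1 h2] := trunc_log_bounds (isT : 1 < 2) n_gt0.
rewrite /edge_bound; move: h1 h2; rewrite expnS.
by move: (2 ^ trunc_log 2 n) => p h1 h2; nia.
Qed.

Variable w : nat.
Hypothesis hm : edge_bound < 2 ^ w.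

Let hw : 16 * (n * n) < 2 ^ w.
Proof. by have /andP[h _] := edge_boundP; apply: leq_ltn_trans h hm. Qed.

Let nn_gt0 : 0 < n * n. Proof. by rewrite muln_gt0 n_gt0. Qed.

Variable A : nat -> bool.
Variable alpha : nat -> nat -> nat.
Hypothesis alpha0 : forall q, alpha 0 q = A q.

Definition built (L : seq code) : state :=
  State (fun=> 0) (fun a => if a == 0 then nth 0 (map (src n) L)
    else if a == 1 then nth 0 (map (tgt n) L) else fun=> 0).

Lemma upd_nth_rcons (s : seq nat) x : upd (nth 0 s) (size s) x = nth 0 (rcons s x).
Proof.
apply: funext => i; rewrite /upd nth_rcons; case: ltngtP => // h.
by rewrite nth_default // ltnW.
Qed.

Lemma exec_emit rho ty q L : env n rho -> at_pos n rho q -> valid n (ty, q) ->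
  rho 19 = size L -> (size L).+1 < 2 ^ w ->
  exists t rho', [/\ exec w (emit_cmd ty) (join rho alpha (built L)) t
      (join rho' alpha (built (rcons L (ty, q)))), t <= 10,
      frame 14 19 rho rho' & rho' 19 = (size L).+1].
Proof.
move=> e hp hv h19 sz.
have [t [rho1 [x1 l1 [h14 h16] f1 _]]] := exec_load n_gt0 hw alpha (built L) e hp hv.
have e1 : env n rho1 by apply: env_frame f1 e.
have E19 : rho1 19 = size L by rewrite f1.
pose rho2 := upd rho1 19 (size L).+1.
exists (t + (1 + (1 + 1))), rho2; split=> //.
- apply: exec_seq x1 _.
  have := exec_write w 4 19 14 (join rho1 alpha (built L)).
  rewrite (set_arr_join_shift _ _ _ 0) !reg_join // E19 h14.
  move/exec_seq; apply; set s1 := set_arr _ _ _.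
  have := exec_write w 5 19 16 (join rho1 alpha s1).
  rewrite (set_arr_join_shift _ _ _ 1) !reg_join // E19 h16.
  move/exec_seq; apply; set s2 := set_arr _ _ _.
  have -> : s2 = built (rcons L (ty, q)).
    rewrite /s2 /s1 /set_arr /built /=; congr State; apply: funext => a.
    rewrite /upd; case: a => [|[|a]] //=.
      by rewrite map_rcons -upd_nth_rcons size_map.
    by rewrite map_rcons -upd_nth_rcons size_map.
  have := @exec_own w alpha rho1 (built (rcons L (ty, q))) (Op WAdd 19 19 11) isT.
  by rewrite /= E19 (env11 e1) eval_add addn1.
- by lia.
- move=> r h0 hr; rewrite /rho2 /upd; case: eqP => [E|_]; first by rewrite E in hr.
  by rewrite f1 //; lia.
Qed.

Lemma exec_emits rho tys q L : env n rho -> at_pos n rho q -> q < n * n ->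
  all (fun ty => ty < 11) tys ->
  rho 19 = size L -> size L + size tys < 2 ^ w ->
  exists t rho', [/\ exec w (emits tys) (join rho alpha (built L)) t
      (join rho' alpha (built (L ++ [seq (ty, q) | ty <- tys]))),
      t <= 1 + 10 * size tys,
      frame 14 19 rho rho' & rho' 19 = size L + size tys].
Proof.
move=> + + hq; elim: tys rho L => [|ty tys IH] rho L e hp /=.
  move=> _ h19 _; exists 1, rho; split; rewrite ?cats0 ?addn0 //.
  exact: exec_skip.
case/andP=> hty htys h19 sz.
have hv : valid n (ty, q) by rewrite /valid hty.
have sz1 : (size L).+1 < 2 ^ w by lia.
have [t [rho1 [x1 l1 f1 h1]]] := exec_emit e hp hv h19 sz1.
have e1 : env n rho1 by apply: env_frame f1 e.
have [] := IH rho1 (rcons L (ty, q)) e1 (at_pos_frame f1 isT hp) htys.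
- by rewrite size_rcons.
- by rewrite size_rcons; lia.
move=> t2 [rho2 [x2 l2 f2 h2]]; exists (t + t2), rho2; split.
- by apply: exec_seq x1 _; move: x2; rewrite cat_rcons.
- by lia.
- exact: frame_trans f1 f2.
- by rewrite h2 size_rcons; lia.
Qed.

Variable dir : direction.

Lemma size_init_codes m : size (init_codes dir A m) <= 11 * m.
Proof.
elim: m => [//|m IH]; rewrite init_codesS size_cat mulnS addnC leq_add //.
by rewrite size_map /init_types; case: (A m); case: dec.
Qed.

Lemma exec_build_body rho q : env n rho -> q < n * n -> rho 3 = q ->
  rho 19 = size (init_codes dir A q) ->
  exists t rho', [/\ exec w (build_body dir) (join rho alpha (built (init_codes dir A q))) t
      (join rho' alpha (built (init_codes dir A q.+1))), t <= 130,
      env n rho' /\ rho' 19 = size (init_codes dir A q.+1),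
      rho' 3 = q.+1 /\ rho' 5 = (q.+1 < n * n) & rho' 2 = rho 2 /\ rho' 20 = rho 20].
Proof.
move=> e hq h3 h19; set L := init_codes dir A q in h19 *.
have szL : size L + 11 < 2 ^ w.
  have : size L <= 11 * q by apply: size_init_codes.
  by lia.
have w1 : 1 < 2 ^ w by lia.
have [t1 [rho1 [x1 l1 p1 f1 _]]] :=
  exec_setup n_gt0 hw alpha Decremental (built L) e h3 hq.
have {}p1 : at_pos n rho1 q := p1.
have e1 : env n rho1 by apply: env_frame f1 e.
have [] := @exec_emits rho1 [:: 0; 1; 2; 3] q L e1 p1 hq isT.
- by rewrite f1.
- by rewrite /=; lia.
move=> t2 [rho2 [x2 l2 f2 h2]].
have e2 : env n rho2 by apply: env_frame f2 e1.
have p2 := at_pos_frame f2 isT p1.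
set L2 := L ++ _ in x2.
have sz2 : size L2 = size L + 4 by rewrite size_cat.
pose rho3 := upd rho2 14 (A q).
have x3 : exec w (Read 14 0 8) (join rho2 alpha (built L2)) 1 (join rho3 alpha (built L2)).
  have := @exec_own w alpha rho2 (built L2) (Read 14 0 8) isT.
  by rewrite /= (p2 2) // alpha0.
have f3 : frame 14 19 rho2 rho3.
  by move=> r _ hr; rewrite /rho3 /upd; case: eqP => // E; rewrite E in hr.
have e3 : env n rho3 by apply: env_frame f3 e2.
have p3 := at_pos_frame f3 isT p2.
have E14 : reg (join rho3 alpha (built L2)) 14 = A q by rewrite reg_join // /rho3 /upd eqxx.
pose L4 := L2 ++ [seq (ty, q) | ty <- if A q then [:: 4; 5; 6] else [::]].
have [t4 [rho4 [x4 l4 f4 h4]]] : exists t rho4, [/\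
    exec w (If 14 (emits [:: 4; 5; 6]) Skip) (join rho3 alpha (built L2)) t
      (join rho4 alpha (built L4)), t <= 32, frame 14 19 rho3 rho4 &
    rho4 19 = size L4].
  rewrite /L4; case: (boolP (A q)) E14 => Aq E14.
    have [] := @exec_emits rho3 [:: 4; 5; 6] q L2 e3 p3 hq isT.
    - by rewrite -[LHS]/(rho2 19) h2 sz2.
    - by rewrite sz2 /=; lia.
    move=> t [rho' [y1 y2 y3 y4]]; exists t.+1, rho'; split=> //.
      by apply: exec_if; rewrite E14; apply: y1.
    by rewrite y4 size_cat.
  exists 2, rho3; split=> //; last by rewrite -[LHS]/(rho2 19) h2 cats0 sz2.
  apply: exec_if; rewrite E14 cats0.
  exact: exec_skip.
have e4 : env n rho4 by apply: env_frame f4 e3.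
have p4 := at_pos_frame f4 isT p3.
have sz4 : size L4 <= size L + 7.
  by rewrite size_cat sz2 size_map; case: (A q) => /=; lia.
have [] := @exec_emits rho4 (if dec dir then [:: 7; 8; 9; 10] else [::]) q L4 e4 p4 hq.
- by case: dec.
- by [].
- by apply: leq_ltn_trans szL; case: dec => /=; lia.
move=> t5 [rho5 [x5 l5 f5 h5]].
have e5 : env n rho5 by apply: env_frame f5 e4.
have EL : L4 ++ [seq (ty, q) | ty <- if dec dir then [:: 7; 8; 9; 10] else [::]]
    = init_codes dir A q.+1.
  by rewrite init_codesS -!catA -!map_cat.
have sz5 : size (if dec dir then [:: 7; 8; 9; 10] else [::]) <= 4 by case: dec.
pose rho6 := foldl (step w alpha) rho5 [:: Op WAdd 3 3 11; Op WLt 5 3 13].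
have x6 := @exec_block w alpha rho5 (built (init_codes dir A q.+1))
  [:: Op WAdd 3 3 11; Op WLt 5 3 13] isT.
have f15 : frame 14 19 rho1 rho5.
  exact: frame_trans f2 (frame_trans f3 (frame_trans f4 f5)).
have f6 : frame 3 5 rho5 rho6.
  move=> r _ hlr; have ne y : 3 <= y <= 5 -> (r == y) = false.
    by move=> hy; apply: contraNF hlr => /eqP ->.
  by rewrite /rho6 /= /upd !ne.
have E3 : rho6 3 = q.+1.
  have -> : rho6 3 = eval_binop w WAdd (rho5 3) (rho5 11) by [].
  by rewrite f15 // f1 // h3 (env11 e5) eval_add addn1 //; lia.
have e6 : env n rho6 by apply: env_frame f6 e5.
exists (t1 + (t2 + (1 + (t4 + (t5 + 3))))), rho6; split.
- apply: exec_seq x1 _; apply: exec_seq x2 _; apply: exec_seq x3 _.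
  by apply: exec_seq x4 _; apply: exec_seq x5 _; rewrite EL.
- by move: l2 l5; rewrite /=; lia.
- by split=> //; rewrite f6 // h5 -EL size_cat size_map.
- split=> //.
  have -> : rho6 5 = eval_binop w WLt (rho6 3) (rho6 13) by [].
  by rewrite E3 (env13 e6) eval_lt.
- by split; rewrite f6 // f15 // f1.
Qed.

Lemma exec_build rho q : env n rho -> q <= n * n -> rho 3 = q ->
  rho 5 = (q < n * n) -> rho 19 = size (init_codes dir A q) ->
  exists t rho', [/\ exec w (While 5 (build_body dir))
      (join rho alpha (built (init_codes dir A q))) t
      (join rho' alpha (built (init_codes dir A (n * n)))), t <= 1 + 131 * (n * n - q),
      env n rho', rho' 19 = size (init_codes dir A (n * n))
    & rho' 2 = rho 2 /\ rho' 20 = rho 20].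
Proof.
move: {2}(n * n - q) (leqnn (n * n - q)) => m.
elim: m rho q => [|m IH] rho q hm' e hq h3 h5 h19.
  have -> : q = n * n by lia.
  exists 1, rho; split=> //; last by rewrite h19; congr (size (init_codes _ _ _)); lia.
  by apply: exec_while_stop; rewrite reg_join // h5; lia.
case: (ltnP q (n * n)) => hlt; last by apply: IH => //; lia.
have [t1 [rho1 [x1 l1 [e1 h1] [h13 h15] [h12 h1p]]]] := exec_build_body e hlt h3 h19.
have hm1 : n * n - q.+1 <= m by lia.
have [t2 [rho2 [x2 l2 e2 h2 [h22 h2p]]]] := IH _ _ hm1 e1 hlt h13 h15 h1.
exists (t1 + t2).+1, rho2; split=> //; last by rewrite h22 h2p.
  by apply: exec_while_step x1 x2; rewrite reg_join // h5 hlt.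
by lia.
Qed.

(** Register 20 is doubled while its double is at most [n]; register 15 holds [n + 1] so that [<]
    tests [<=]. The fuel [f] is a crude linear bound on the number of doublings, good enough for
    polynomial preprocessing. *)
Lemma exec_power f j rho s : env n rho -> 2 ^ j <= n -> n - 2 ^ j <= f ->
  rho 20 = 2 ^ j -> rho 15 = n.+1 -> rho 5 = (2 ^ j.+1 <= n) ->
  exists t rho', [/\ exec w (While 5 power_body) (join rho alpha s) t (join rho' alpha s),
      t <= 1 + 5 * f, env n rho', rho' 20 = 2 ^ trunc_log 2 n
    & rho' 2 = rho 2 /\ rho' 19 = rho 19].
Proof.
have w1 : 1 < 2 ^ w by lia.
have hn : n <= n * n by rewrite leq_pmulr.
elim: f j rho => [|f IH] j rho e hj hf h20 h15 h5; case: (leqP (2 ^ j.+1) n) => hlt.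
1: by exfalso; move: hlt hf; rewrite expnS; have := expn_gt0 2 j; lia.
1,3: exists 1, rho; split=> //;
  [ by apply: exec_while_stop; rewrite reg_join // h5 leqNgt hlt
  | by rewrite h20 (@trunc_log_eq 2 j n) // hj ].
pose cs := [:: Op WAdd 20 20 20; Op WAdd 14 20 20; Op WLt 5 14 15].
pose rho1 := foldl (step w alpha) rho cs.
have E2 : 2 ^ j.+1 = 2 ^ j + 2 ^ j by rewrite expnS mul2n addnn.
have E2' : 2 ^ j.+2 = 2 ^ j.+1 + 2 ^ j.+1 by rewrite expnS mul2n addnn.
have E20 : rho1 20 = 2 ^ j.+1.
  have -> : rho1 20 = eval_binop w WAdd (rho 20) (rho 20) by [].
  by rewrite h20 E2 eval_add //; lia.
have E14 : rho1 14 = 2 ^ j.+2.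
  have -> : rho1 14 = eval_binop w WAdd (rho1 20) (rho1 20) by [].
  by rewrite E20 E2' eval_add //; lia.
have E5 : rho1 5 = (2 ^ j.+2 <= n).
  have -> : rho1 5 = eval_binop w WLt (rho1 14) (rho 15) by [].
  by rewrite E14 h15 eval_lt.
have e1 : env n rho1 by case: e.
have pos : 0 < 2 ^ j by rewrite expn_gt0.
have hf1 : n - 2 ^ j.+1 <= f by lia.
have [t [rho' [x l e' h1 [h2 h3]]]] := IH _ _ e1 hlt hf1 E20 h15 E5.
exists (4 + t).+1, rho'; split=> //; last by lia.
apply: exec_while_step x; first by rewrite reg_join // h5 hlt.
exact: (@exec_block w alpha rho s cs isT).
Qed.

(** * The preprocessing program *)

Variable P : stsp_alg.

Definition init_cmds : seq cmd :=
  [:: Op WAdd 1 0 31; Const 11 1; Const 12 8; Op WMul 13 1 1; Const 20 1;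
      Op WAdd 15 1 11; Op WAdd 14 20 20; Op WLt 5 14 15].

Definition size_cmds : seq cmd :=
  [:: Const 14 64; Op WMul 15 20 20; Op WMul 14 14 15; Const 16 16; Op WMul 16 16 13].

Definition pre_cmd : cmd :=
  Seq (block init_cmds) (Seq (While 5 power_body)
    (Seq (block [:: Const 3 0; Op WLt 5 3 13]) (Seq (While 5 (build_body dir))
      (Seq (block size_cmds)
        (Seq (Op WAdd 32 14 31) (Seq (Op WAdd 33 16 31)
          (Seq (Op WAdd 35 11 31) (Seq (Op WAdd 36 19 31) (shift (stsp_pre P)))))))))).

Definition initial_graph : seq ('I_(graph_order n) * 'I_(graph_order n)) :=
  map (oedge n) (init_codes dir A (n * n)).

(** Register 2 holds [s], which is vertex 0, and is 0 already; so only registers 0, 1, 3 and 4 are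
    set. *)
Lemma built_stsp_init :
  let L := init_codes dir A (n * n) in
  set_reg (set_reg (set_reg (set_reg (built L) 0 edge_bound) 1 (16 * (n * n))) 3 1)
    4 (size L)
  = stsp_init edge_bound (inord 0) (inord 1) initial_graph.
Proof.
move=> L; have S := sched_init dir n_gt0 A (fun _ _ => false).
have vL : all (valid n) L := sched_valid S.
rewrite /set_reg /stsp_init /built /=; congr State; apply: funext => a.
  rewrite /upd size_map; case: a => [|[|[|[|[|a]]]]] //=.
  - by rewrite -(graph_orderE n_gt0).
  - by rewrite inordK.
  - by rewrite inordK // -/(graph_order n) graph_orderE //; lia.
  - by rewrite nth_nil.
case: a => [|[|a]] //=; rewrite /initial_graph -map_comp; congr nth;
  apply/eq_in_map => e /(allP vL) ve; rewrite /= inordK //.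
  exact: src_lt.
exact: tgt_lt.
Qed.

Lemma exec_pre rho t0 s0 : rho 0 = n -> (forall r, 0 < r -> rho r = 0) ->
  exec w (stsp_pre P) (stsp_init edge_bound (inord 0) (inord 1) initial_graph) t0 s0 ->
  exists t rho', [/\ exec w pre_cmd (join rho alpha blank) t (join rho' alpha s0),
    t <= 300 * (n * n) + t0, env n rho' & rho' 2 = 0].
Proof.
move=> h0 hr hpre; have /andP[hm1 hm2] := edge_boundP.
have w1 : 1 < 2 ^ w by lia.
have hn : n <= n * n by rewrite leq_pmulr.
have hsz := size_init_codes (n * n).
pose rho1 := foldl (step w alpha) rho init_cmds.
have x1 := @exec_block w alpha rho blank init_cmds isT.
have E1 : rho1 1 = n.
  have -> : rho1 1 = eval_binop w WAdd (rho 0) (rho 31) by [].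
  by rewrite h0 hr // eval_add addn0 //; lia.
have E11 : rho1 11 = 1 by rewrite -[LHS]/(1 %% 2 ^ w) modn_small.
have E12 : rho1 12 = 8 by rewrite -[LHS]/(8 %% 2 ^ w) modn_small //; lia.
have E20 : rho1 20 = 2 ^ 0 by rewrite -[LHS]/(1 %% 2 ^ w) modn_small.
have e1 : env n rho1.
  split=> //; last by rewrite -[LHS]/(rho 31) hr.
  have -> : rho1 13 = eval_binop w WMul (rho1 1) (rho1 1) by [].
  by rewrite E1 eval_mul //; lia.
have E15 : rho1 15 = n.+1.
  have -> : rho1 15 = eval_binop w WAdd (rho1 1) (rho1 11) by [].
  by rewrite E1 E11 eval_add addn1 //; lia.
have E5 : rho1 5 = (2 ^ 1 <= n).
  have -> : rho1 5 = eval_binop w WLt (rho1 14) (rho1 15) by [].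
  have -> : rho1 14 = eval_binop w WAdd (rho1 20) (rho1 20) by [].
  by rewrite E15 E20 eval_lt // eval_add //; lia.
have [t2 [rho2 [x2 l2 e2 h20 [h22 h29]]]] :=
  exec_power blank e1 (n_gt0 : 2 ^ 0 <= n) (leq_subr _ _) E20 E15 E5.
pose cs := [:: Const 3 0; Op WLt 5 3 13].
pose rho3 := foldl (step w alpha) rho2 cs.
have x3 := @exec_block w alpha rho2 blank cs isT.
have e3 : env n rho3 by case: e2.
have E3 : rho3 3 = 0 by rewrite -[LHS]/(0 %% 2 ^ w) mod0n.
have E35 : rho3 5 = (0 < n * n).
  have -> : rho3 5 = eval_binop w WLt (rho3 3) (rho3 13) by [].
  by rewrite E3 (env13 e3) eval_lt.
have E319 : rho3 19 = size (init_codes dir A 0).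
  by rewrite -[LHS]/(rho2 19) h29 -[LHS]/(rho 19) hr.
have [t4 [rho4 [x4 l4 e4 h49 [h42 h4p]]]] := exec_build e3 (leq0n _) E3 E35 E319.
have B0 : built (init_codes dir A 0) = blank.
  rewrite /built /blank; congr State; apply: funext => a; apply: funext => i.
  by case: a => [|[|a]] //=; case: i.
rewrite B0 in x4; set L := init_codes dir A (n * n) in x4 h49 hsz.
pose rho5 := foldl (step w alpha) rho4 size_cmds.
have x5 := @exec_block w alpha rho4 (built L) size_cmds isT.
have e5 : env n rho5 by case: e4.
have E5_19 : rho5 19 = size L by [].
have E5_14 : rho5 14 = edge_bound.
  have -> : rho5 14 = eval_binop w WMul (64 %% 2 ^ w) (rho5 15) by [].
  have -> : rho5 15 = eval_binop w WMul (rho4 20) (rho4 20) by [].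
  rewrite h4p -[rho3 20]/(rho2 20) h20; move: hm; rewrite /edge_bound.
  move: (2 ^ trunc_log 2 n) (expn_gt0 2 (trunc_log 2 n)) => p p0 hp.
  have pp : 0 < p * p by rewrite muln_gt0 p0.
  by rewrite (@eval_mul _ p) ?modn_small ?eval_mul //; lia.
have E5_16 : rho5 16 = 16 * (n * n).
  have -> : rho5 16 = eval_binop w WMul (16 %% 2 ^ w) (rho4 13) by [].
  by rewrite (env13 e4) modn_small ?eval_mul //; lia.
exists (9 + (t2 + (3 + (t4 + (6 + (1 + (1 + (1 + (1 + t0))))))))), rho5; split=> //.
- apply: exec_seq x1 _; apply: exec_seq x2 _; apply: exec_seq x3 _.
  apply: exec_seq x4 _; apply: exec_seq x5 _.
  apply: exec_seq (@exec_move n w alpha _ _ 0 14 e5 isT _) _; first by rewrite E5_14.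
  apply: exec_seq (@exec_move n w alpha _ _ 1 16 e5 isT _) _; first by rewrite E5_16.
  apply: exec_seq (@exec_move n w alpha _ _ 3 11 e5 isT _) _; first by rewrite (env11 e5).
  apply: exec_seq (@exec_move n w alpha _ _ 4 19 e5 isT _) _; first by rewrite E5_19; lia.
  apply: exec_shift; rewrite E5_14 E5_16 E5_19 (env11 e5).
  by rewrite built_stsp_init.
- by lia.
- by rewrite -[LHS]/(rho4 2) h42 -[LHS]/(rho2 2) h22 -[LHS]/(rho 2) hr.
Qed.

End Preprocessing.

(** * The reduction *)

Section Reduction.
Set Implicit Arguments.
Unset Strict Implicit.
Local Open Scope nat_scope.

(** * One phase per OMv3 query *)

Section Phases.
Variable n : nat.
Hypothesis n_gt0 : 0 < n.
Variable A : 'M[bool]_n.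

Definition vec_bit (u : 'rV[bool]_n) (k : nat) : bool :=
  [exists i : 'I_n, (val i == k) && u ord0 i].

Definition mx_bit (k : nat) : bool :=
  [exists i : 'I_n, exists j : 'I_n, (i * n + j == k) && A i j].

Definition query_bits (q : omv3_query n) (a : nat) : nat -> bool :=
  let: (u, v, w) := q in
  if a == 1 then vec_bit u else if a == 2 then vec_bit v else vec_bit w.

Lemma vec_bitE u (i : 'I_n) : vec_bit u i = u ord0 i.
Proof.
apply/existsP/idP => [[j /andP[/eqP/val_inj->]] //|h].
by exists i; rewrite eqxx.
Qed.

Lemma mx_bitE (i j : 'I_n) : mx_bit (i * n + j) = A i j.
Proof.
apply/existsP/idP => [[i' /existsP[j' /andP[/eqP E]]]|h]; last first.
  by exists i; apply/existsP; exists j; rewrite eqxx.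
suff [-> ->] : i' = i /\ j' = j by [].
split; apply: val_inj => /=.
  by have := congr1 (divn^~ n) E; rewrite !divnMDl // !divn_small // !addn0.
by have := congr1 (modn^~ n) E; rewrite !modnMDl !modn_small.
Qed.

Lemma has_iota_exists (f : nat -> bool) :
  has f (iota 0 n) = [exists i : 'I_n, f i].
Proof.
apply/hasP/existsP => [[i]|[i fi]]; last by exists (val i); rewrite ?mem_iota /= ?add0n ?ltn_ord.
by rewrite mem_iota => hi fi; exists (Ordinal hi).
Qed.

Lemma omv3_answerE (q : omv3_query n) :
  has (fun i => query_bits q 1 i &&
         triangle n mx_bit (query_bits q 2) (query_bits q 3) i) (iota 0 n)
  = omv3_answer A q.
Proof.
case: q => [[u v] w]; rewrite /= has_iota_exists.
rewrite /triangle /three_steps /two_steps.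
apply/existsP/existsP => -[i].
  rewrite vec_bitE has_iota_exists => /andP[ui /existsP[k]].
  rewrite has_iota_exists vec_bitE mx_bitE => /and3P[/existsP[j]].
  rewrite !mx_bitE vec_bitE => /and3P[Aij vj Ajk] wk Aki.
  exists i; apply/existsP; exists j; apply/existsP; exists k.
  by rewrite ui vj wk Aij Ajk.
case/existsP=> j /existsP[k /and5P[ui vj wk Aij /andP[Ajk Aki]]].
exists i; rewrite vec_bitE ui has_iota_exists; apply/existsP; exists k.
rewrite vec_bitE wk mx_bitE Aki has_iota_exists !andbT; apply/existsP; exists j.
by rewrite !mx_bitE vec_bitE Aij vj.
Qed.

Variable dir : direction.

Fixpoint all_reqs (ph : nat) (qs : seq (omv3_query n)) : seq areq :=
  if qs is q :: qs' then
    phase_reqs n dir (query_bits q) ph ++ all_reqs ph.+1 qs'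
  else [::].

Definition phase_start bits (L : seq code) (ph : nat) : Prop :=
  let b := ph * n in sched n dir mx_bit bits L b b b b b b.

(** Between phases the windows [[p, k)] are empty, so the invariant is independent of the bits and
    the vectors of the next query can take over. *)
Lemma phase_start_bits bits bits' L ph :
  phase_start bits L ph -> phase_start bits' L ph.
Proof.
case=> h1 h2 h3 h4 h5 h6 h7; split=> // q hq.
  by have := h4 q hq; case: ifP => // ->.
by have := h5 q hq; case: ifP => // ->.
Qed.

(** The guarantee of the shortest paths algorithm applies to a legal sequence as a whole, so
    legality is settled first, without reference to its answers. *)
Lemma admissible_all bits L ph qs : ph + size qs <= n -> phase_start bits L ph ->
  admissible n dir (fun _ _ => True) L (all_reqs ph qs).
Proof.
elim: qs bits L ph => [//|q qs IH] bits L ph /= sz.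
move/(phase_start_bits (query_bits q)) => S.
have hph : ph < n by lia.
have [] := @phase_achieves n dir n_gt0 _ _ (fun _ _ => True) ph L hph _ S; first by [].
move=> ad S'; apply/admissible_cat; split=> //.
by apply: IH S'; lia.
Qed.

Lemma size_all_reqs ph qs : size (all_reqs ph qs) <= 7 * n * size qs.
Proof.
elim: qs ph => [|q qs IH] ph //=; rewrite size_cat mulnS leq_add //.
exact: size_phase_reqs.
Qed.

Variables (w : nat) (P : stsp_alg).
Hypothesis hw : 16 * (n * n) < 2 ^ w.

Definition put_arrays (q : omv3_query n) (alpha : nat -> nat -> nat) :=
  let: (x, y, z) := q in
  upd (upd (upd alpha 1 (vec_cells x)) 2 (vec_cells y)) 3 (vec_cells z).

Lemma omv3_put_join q rho alpha s :
  omv3_put q (join rho alpha s) = join rho (put_arrays q alpha) s.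
Proof.
case: q => [[x y] z]; rewrite /omv3_put /set_arr /join /=; congr State.
by apply: funext => a; rewrite /upd; case: a => [|[|[|[|a]]]].
Qed.

Lemma put_arraysE q alpha a : 0 < a < 4 -> forall i,
  put_arrays q alpha a i = query_bits q a i.
Proof. by case: q => [[x y] z]; case: a => [|[|[|[|a]]]]. Qed.

(** Induction on the queries: the run and its answers are cut after the first phase, which the
    machine simulates online; the state reached there starts the next phase. *)
Lemma serve_omv3 qs ph bits L rho alpha s rs T : ph + size qs <= n ->
  phase_start bits L ph -> env n rho -> rho 2 = ph ->
  serve w (@stsp_handler P (graph_order n)) (@stsp_put (graph_order n)) s
    (map (creq n) (all_reqs ph qs)) rs T ->
  correct_answers dir (inord 0) (inord 1) (map (oedge n) L)
    (map (creq n) (all_reqs ph qs)) rs ->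
  exists2 t, serve w (fun=> phase_cmd dir P) (@omv3_put n) (join rho alpha s) qs
      [seq nat_of_bool (omv3_answer A q) | q <- qs] t
    & t <= 152 * n * size qs + T.
Proof.
elim: qs ph bits L rho alpha s rs T => [|q qs IH] ph bits L rho alpha s rs T /=.
  by move=> *; exists 0; first exact: serve_nil.
move=> sz /(phase_start_bits (query_bits q)) S e h2; rewrite map_cat.
case/serve_cat=> rs1 [rs2 [T1 [T2 [s1 [r1 r2 -> ->]]]]]; rewrite -map_cat => cor.
have hph : ph < n by lia.
have [vL uL] : all (valid n) L /\ uniq L by case: S.
have [] := @phase_achieves n dir n_gt0 _ _ (ready n mx_bit (query_bits q 2)
  (query_bits q 3)) ph L hph _ S; first by [].
move=> ad S'.
have srs : size rs1 = size (phase_reqs n dir (query_bits q) ph).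
  by rewrite (run_size r1) size_map.
have [cor1 cor2] := correct_answers_cat n_gt0 vL uL ad srs cor.
have [t1 [rho1 [x1 l1 e1 h12 h10]]] :=
  exec_phase n_gt0 hw (put_arraysE q alpha) e hph h2 r1.
have sz' : ph.+1 + size qs <= n by lia.
have [t2 sv l2] := IH _ _ _ _ (put_arrays q alpha) _ _ _ sz' S' e1 h12 r2 cor2.
exists (t1 + t2); last by rewrite mulnS; lia.
have -> : nat_of_bool (omv3_answer A q) = reg (join rho1 (put_arrays q alpha) s1) 0.
  rewrite reg_join // h10 (any_hitE n_gt0 vL uL ad cor1) has_query_phase //.
  by rewrite omv3_answerE.
by apply: serve_cons sv; rewrite omv3_put_join.
Qed.

End Phases.

(** * The resulting OMv3 algorithm and its running time *)

Definition omv3_of_stsp (dir : direction) (P : stsp_alg) : omv3_alg :=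
  OMv3Alg (2 * stsp_wa P) (6 * stsp_wa P + stsp_wb P) (pre_cmd dir P) (phase_cmd dir P).

(** [edge_bound n] is the power of two with exponent [6 + 2 * trunc_log 2 n]. *)
Lemma word_size_edge_bound a b n :
  word_size (2 * a) (6 * a + b) n = word_size a b (edge_bound n).
Proof.
rewrite /word_size /edge_bound -expnD -[64]/(2 ^ 6) -expnD trunc_expnK //.
by rewrite addnn -mul2n mulnDr; lia.
Qed.

Lemma lt_word_size a b m : 0 < a -> 0 < b -> m < 2 ^ word_size a b m.
Proof.
move=> ha hb; apply: leq_trans (trunc_log_ltn m (isT : 1 < 2)) _.
by rewrite leq_exp2l // /word_size -addn1 leq_add // leq_pmull.
Qed.

Lemma omv3_init_join n (A : 'M[bool]_n) :
  omv3_init A = join (fun r => if r == 0 then n else 0)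
    (fun a => if a == 0 then mx_cells A else fun=> 0) blank.
Proof.
rewrite /omv3_init /set_arr /set_reg /join /=; congr State; apply: funext => a.
  by rewrite /upd; case: eqP => [->|] //=; case: ifP.
by rewrite /upd; case: eqP => [->|] //=; case: ifP.
Qed.

(** The factor 25 is 11 for the initial edges, over which updates are amortized, plus 7 for the
    updates and 7 for the queries. *)
Lemma omv3_of_stspP (R : realType) dir P (U Q B : nat -> R) :
  solves_stsp dir P U Q ->
  (forall m, 0 < m -> [/\ (0 <= B m)%R, (U m <= B m)%R & (Q m <= B m)%R]) ->
  solves_omv3 (omv3_of_stsp dir P) (fun n =>
    ((152 * (n * n))%:R + (25 * (n * n))%:R * B (edge_bound n))%R).
Proof.
case=> wa0 wb0 [C [d sol]] hB; split; [by rewrite /= muln_gt0|by rewrite /= addn_gt0 wb0 orbT|].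
exists (300 + C * 64 ^ d), (2 + 2 * d) => n A n_gt0 w.
have [b1 b2] := andP (edge_boundP n_gt0).
have nn0 : 0 < n * n by rewrite muln_gt0 n_gt0.
set m := edge_bound n in b1 b2; have m0 : 0 < m by lia.
have wE : w = word_size (stsp_wa P) (stsp_wb P) m by apply: word_size_edge_bound.
have hm : m < 2 ^ w by rewrite wE lt_word_size.
have hw : 16 * (n * n) < 2 ^ w by apply: leq_ltn_trans hm.
pose L := init_codes dir (mx_bit A) (n * n).
have S := sched_init dir n_gt0 (mx_bit A) (fun _ _ => false).
have [vL uL] : all (valid n) L /\ uniq L by case: S.
have sL : size L <= 11 * (n * n) by apply: size_valid.
have [|||t0 [s0 [x0 l0 sv0]]] := sol m (graph_order n) (inord 0) (inord 1)
  (initial_graph n (mx_bit A) dir) m0.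
- by rewrite graph_orderE.
- exact: simple_graph_oedge.
- by rewrite size_map (leq_trans sL) //; lia.
rewrite -wE in x0 sv0.
pose alpha := fun a => if a == 0 then mx_cells A else fun=> 0.
have [||t1 [rho [x1 l1 e1 h2]]] := @exec_pre n n_gt0 w hm (mx_bit A) alpha _ dir P
  (fun r => if r == 0 then n else 0) t0 s0 erefl _ x0.
- by [].
- by case.
exists t1, (join rho alpha s0); split.
- by rewrite omv3_init_join.
(* Since [m <= 64 n^2], the simulated preprocessing takes at most [C 64^d n^(2 d)] steps. *)
- apply: leq_trans l1 _; rewrite mulnDl leq_add //.
    by rewrite leq_mul2l /= mulnn leq_pexp2l // leq_addr.
  apply: leq_trans l0 _; rewrite -mulnA leq_mul2l; apply/orP; right.
  apply: leq_trans (_ : (64 * (n * n)) ^ d <= _); first by case: (d) => [|d1] //; rewrite leq_exp2r.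
  rewrite expnMn leq_mul2l mulnn -expnM; apply/orP; right.
  by rewrite leq_pexp2l // leq_addl.
move=> qs; have szq := size_tuple qs.
have ad : admissible n dir (fun _ _ => True) L (all_reqs dir 0 qs).
  by apply: (@admissible_all n n_gt0 A dir (fun _ _ => false)); rewrite ?szq.
have leg : legal dir m (map (oedge n) L) (map (creq n) (all_reqs dir 0 qs)).
  by apply: admissible_legal ad => //; lia.
have [rs [T [sv cor lT]]] := sv0 _ leg.
have [] := @serve_omv3 n n_gt0 A dir w P hw qs 0 (fun _ _ => false) L rho alpha
  s0 rs T _ S e1 h2 sv cor.
  by rewrite szq.
move=> t svt lt; exists t; split=> //.
have szr : size (map (creq n) (all_reqs dir 0 qs)) <= 7 * (n * n).
  by rewrite size_map (leq_trans (size_all_reqs n_gt0 _ _ _)) // szq -mulnA.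
have [B0 BU BQ] := hB m m0.
have lt' : t <= 152 * (n * n) + T by move: lt; rewrite szq -mulnA.
apply: Order.POrderTheory.le_trans (_ : (152 * (n * n) + T)%:R <= _)%R.
  by rewrite ler_nat.
rewrite natrD lerD2l; apply: Order.POrderTheory.le_trans lT _.
set os := map _ _ in szr *; rewrite size_map -/L.
set a := size L + _; set b := count _ _.
have -> : 25 * (n * n) = 18 * (n * n) + 7 * (n * n) by lia.
rewrite natrD mulrDl lerD //.
  apply: Order.POrderTheory.le_trans (_ : a%:R * B m <= _)%R.
    by rewrite ler_wpM2l.
  rewrite ler_wpM2r // ler_nat /a.
  by have := count_size (fun o => ~~ is_query o) os; lia.
apply: Order.POrderTheory.le_trans (_ : b%:R * B m <= _)%R.
  by rewrite ler_wpM2l.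
by rewrite ler_wpM2r // ler_nat /b; have := count_size (@is_query _) os; lia.
Qed.

End Reduction.

(** * Comparison of exponents *)

Section Exponents.
Variable R : realType.

(** A single query on the graph with one vertex and no edges takes at least one step, all of it
    charged to [Q m]. *)
Lemma stsp_query_ge1 dir P (U Q : nat -> R) m : solves_stsp dir P U Q ->
  (0 < m)%N -> 1 <= Q m.
Proof.
case=> _ _ [C [d sol]] m0.
have [t0 [s0 [_ _ sv]]] := sol m 1%N ord0 ord0 [::] m0 m0 isT isT.
have [rs [T [sv1 _ lT]]] := sv [:: Query] isT.
have T0 : (0 < T)%N.
  move E : [:: Query] sv1 => os h.
  by case: h E => // o os' rs' s s' t T' /exec_gt0 x _ _; rewrite addn_gt0 x.
move: lT; rewrite /= mul0r add0r mul1r; apply: le_trans.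
by rewrite -[1]/(1%:R) ler_nat.
Qed.

(** As soon as [n] exceeds [K^(1/eps)], [K n^(-eps)] drops below 1. *)
Lemma needs_pow_le0 (f : nat -> R) (e : R) : (forall m, (0 < m)%N -> 1 <= f m) ->
  e <= 0 -> needs_pow f e.
Proof.
move=> f1 e0 eps K eps0; have [K1|K1] := ltP K 1.
  by exists 1%N => //; rewrite powR1 mulr1 (lt_le_trans K1) ?f1.
have K0 : 0 < K by apply: lt_le_trans K1.
pose x := K `^ eps^-1; pose n := (Num.truncn x).+1.
have xn : x < n%:R by apply: truncnS_gt.
have n1 : 1 <= n%:R :> R by rewrite ler1n.
exists n => //; apply: lt_le_trans (f1 n isT).
have Kn : K < n%:R `^ eps.
  have {1}-> : K = x `^ eps by rewrite -powRrM mulVf ?gt_eqF // powRr1 // ltW.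
  by rewrite gt0_ltr_powR ?nnegrE ?powR_ge0 ?ler0n.
apply: le_lt_trans (_ : K * n%:R `^ (- eps) < _).
  rewrite ler_wpM2l ?(ltW K0) // ler_powR //.
  by rewrite lerBlDr addrC subrr.
by rewrite powRN ltr_pdivrMr ?mul1r ?powR_gt0 ?ltr0n.
Qed.

Lemma not_needs_pow (f : nat -> R) (e : R) : ~ needs_pow f e ->
  exists2 eps : R, 0 < eps &
    exists K : R, forall n, (0 < n)%N -> f n <= K * n%:R `^ (e - eps).
Proof.
move/existsNP=> [eps /existsNP[K /not_implyP[eps0 h]]]; exists eps => //.
exists K => n n0; rewrite leNgt; apply/negP => hn; apply: h.
by exists n.
Qed.

Lemma edge_bound_powR n (d : R) : (0 < n)%N -> 0 <= d ->
  (n * n)%:R * (edge_bound n)%:R `^ d <= 64 `^ d * n%:R `^ (2 + 2 * d).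
Proof.
move=> n0 d0; have [_ b2] := andP (edge_boundP n0).
have np : 0 < n%:R :> R by rewrite ltr0n.
have -> : (n * n)%:R = n%:R `^ 2 :> R by rewrite natrM -expr2 powR_mulrn // ler0n.
rewrite (powRD (r := 2) (s := 2 * d)); last by rewrite (gt_eqF np) implybT.
rewrite mulrCA ler_wpM2l ?powR_ge0 //.
apply: le_trans (_ : (64 * (n * n))%:R `^ d <= _).
  by rewrite ge0_ler_powR ?nnegrE ?ler0n // ler_nat.
rewrite natrM powRM ?ler0n // ler_wpM2l ?powR_ge0 //.
by rewrite natrM -expr2 -powR_mulrn ?ler0n // -powRrM.
Qed.

End Exponents.

Theorem theorem3 (R : realType) (F : fieldType) :
  let omega : R := mm_exponent R F in
  OMv3_hypothesis omega ->
  forall (dir : direction) (P : stsp_alg) (U Q : nat -> R),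
    solves_stsp dir P U Q ->
    needs_pow U ((omega - 1) / 2) \/ needs_pow Q ((omega - 1) / 2).
Proof.
move=> omega hyp dir P U Q sol; set e := (omega - 1) / 2.
have [e0|e0] := leP e 0.
  by right; apply: needs_pow_le0 e0 => m; apply: stsp_query_ge1 sol.
apply: contrapT => /not_orP[/not_needs_pow[eps1 eps1_gt0 [K1 hU]]].
move=> /not_needs_pow[eps2 eps2_gt0 [K2 hQ]].
(* The minimum with [e] keeps [e - eps] nonnegative, as [edge_bound_powR] requires. *)
pose eps := Num.min e (Num.min eps1 eps2).
have eps_gt0 : 0 < eps by rewrite !lt_min e0 eps1_gt0.
have eps_e : eps <= e by rewrite ge_min lexx.
have d0 : 0 <= e - eps by rewrite subr_ge0.
pose K := `|K1| + `|K2|.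
have K0 : 0 <= K by rewrite addr_ge0.
pose B (m : nat) : R := K * m%:R `^ (e - eps).
have hB m : (0 < m)%N -> [/\ 0 <= B m, U m <= B m & Q m <= B m].
  move=> m0; have m1 : 1 <= m%:R :> R by rewrite ler1n.
  have bound K' eps' : `|K'| <= K -> eps <= eps' ->
      K' * m%:R `^ (e - eps') <= B m.
    move=> hK' heps'; apply: le_trans (ler_norm _) _; rewrite normrM.
    rewrite [`|_ `^ _|]ger0_norm ?powR_ge0 // ler_pM ?powR_ge0 //.
    by rewrite ler_powR // lerD2l lerN2.
  split; first by rewrite mulr_ge0 ?powR_ge0.
    apply: le_trans (hU m m0) (bound _ _ _ _); first by rewrite lerDl.
    by rewrite !ge_min lexx orbT.
  apply: le_trans (hQ m m0) (bound _ _ _ _); first by rewrite lerDr.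
  by rewrite !ge_min lexx !orbT.
(* As [m] is of order [n^2], a saving of [eps] in the exponent of [m] becomes [2 eps] in that of
   [n]. *)
have [|n n0] := hyp _ _ (omv3_of_stspP sol hB) (2 * eps)
  (152 + 25 * (K * 64 `^ (e - eps))).
  by rewrite mulr_gt0.
have -> : omega + 1 - 2 * eps = 2 + 2 * (e - eps).
  by rewrite /e; field.
apply/negP; rewrite -leNgt mulrDl lerD //.
  rewrite natrM ler_wpM2l // natrM -expr2 -powR_mulrn ?ler0n //.
  by rewrite ler_powR ?ler1n // lerDl mulr_ge0.
rewrite natrM -!mulrA ler_wpM2l // /B mulrCA ler_wpM2l //.
exact: edge_bound_powR.
Qed.
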